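(* For every integer $N\ge 2$, the element $T_N$ (the lexicographically ordered product of quantum exponentials defined in the context) satisfies $$T_N=\mu_1(T_N)=\mu_2(T_N)=\mu_3(T_N)$$ and $$T_N=\rho(T_N)=\rho(\rho(T_N)).$$
   Context: Fix real $q\in(0,1)$. The quantum exponential is the formal series $\langle x\rangle_q=\sum_{n\ge 0}\frac{(-x)^n}{(1-q)(1-q^2)\cdots(1-q^n)}$. Quiver $Q_N$: its vertices are pairs of integers $(i,j)$ with $1\le i<j\le N$; its directed edges go from $(i,j)$ to $(i,j+1)$, from $(i,j)$ to $(i+1,j)$, and from $(i+1,j+1)$ to $(i,j)$, whenever both endpoints are vertices. Its skew-symmetric incidence matrix $B$ is: $B_{(i,j),(i',j')}=-B_{(i',j'),(i,j)}=1$ if there is a directed edge from $(i,j)$ to $(i',j')$, and $B_{(i,j),(i',j')}=0$ if the two vertices are not connected. $\mathcal T_N$ is the unital associative $\mathbb R$-algebra with generators $Z_{ij}$, $1\le i<j\le N$, and defining relations $Z_{ij}Z_{i'j'}=q^{B_{(i,j),(i',j')}}Z_{i'j'}Z_{ij}$. Quantum exponentials of monomials in the generators are formal series; they are regarded as elements of the completion of $\mathcal T_N$ consisting of all formal (possibly infinite) $\mathbb R$-linear combinations of the ordered monomials $\prod_{i<j}Z_{ij}^{\alpha_{ij}}$, $\alpha_{ij}\in\mathbb Z_{\ge0}$, and the maps below are extended to this completion. $\rho$ is the algebra automorphism (of order three) with $\rho(Z_{ij})=Z_{j-i,\,N+1-i}$. $\mu_1,\mu_2,\mu_3$ are the involutive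 algebra anti-automorphisms with $\mu_1(Z_{ij})=Z_{j-i,\,j}$, $\mu_2(Z_{ij})=Z_{N+1-j,\,N+1-i}$, $\mu_3(Z_{ij})=Z_{i,\,N+1+i-j}$. Let $\Lambda_N=\{(a,b,c)\in\mathbb Z^3: 1\le a<b<c\le N+1\}$. For $\lambda=(a,b,c)\in\Lambda_N$ put $\mathbb R_{\lambda}=\mathbb R_{abc}=\langle Z_{a,b}Z_{a+1,b+1}\cdots Z_{a+c-b-1,\,c-1}\rangle_q$ (the product of $Z_{a+k,b+k}$ over $k=0,\dots,c-b-1$, with $k$ increasing from left to right). Then $T_N=\prod^{\rightarrow}_{\lambda\in\Lambda_N}\mathbb R_\lambda$, the product being taken with factors from left to right in increasing lexicographic order of $\lambda$. *)

(* Defs.v *)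
From HB Require Import structures.
From mathcomp Require Import all_boot all_order all_algebra.
From mathcomp Require Import boolp classical_sets functions cardinality fsbigop.
From mathcomp Require Import reals.
From mathcomp Require Import zify ring lra.

Set Implicit Arguments.
Unset Strict Implicit.
Unset Printing Implicit Defensive.
Import Order.TTheory GRing.Theory Num.Theory.
Local Open Scope ring_scope.

Lemma pairwise_rev (T : Type) (r : rel T) (s : seq T) :
  pairwise r (rev s) = pairwise (fun x y => r y x) s.
Proof. by elim: s => //= x s IH; rewrite rev_cons pairwise_rcons all_rev IH. Qed.

Section Box.
Variables (V : finType).
Implicit Types (a b c : {ffun V -> nat}).

Definition emb m (x : {ffun V -> 'I_m.+1}) : {ffun V -> nat} :=
  [ffun v => nat_of_ord (x v)].

Lemma emb_inj m : injective (@emb m).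
Proof.
move=> x y /ffunP h; apply/ffunP => v; apply/val_inj.
by have := h v; rewrite !ffunE.
Qed.

Lemma emb_surj m c : (forall v, c v <= m)%N -> {x | emb x = c :> {ffun V -> nat} & x \in @predT {ffun V -> 'I_m.+1}}.
Proof.
move=> h; exists [ffun v => inord (c v) : 'I_m.+1] => //.
by apply/ffunP => v; rewrite !ffunE inordK // ltnS.
Qed.

Lemma addfE a b v : (a + b) v = (a v + b v)%N.
Proof. by rewrite ffunE. Qed.

Lemma sum_split (R : nmodType) m c (F : _ -> R) : (forall v, c v <= m)%N ->
  \sum_(p \in [set p : {ffun V -> nat} * {ffun V -> nat} | p.1 + p.2 = c]%classic) F p
  = \sum_(x : {ffun V -> 'I_m.+1}) \sum_(y : {ffun V -> 'I_m.+1} | emb x + emb y == c)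
     F (emb x, emb y).
Proof.
move=> hc; rewrite pair_big_dep /=.
pose h (p : {ffun V -> 'I_m.+1} * {ffun V -> 'I_m.+1}) := (emb p.1, emb p.2).
transitivity (\sum_(p <- map h [seq p <- index_enum _ | emb p.1 + emb p.2 == c]) F p);
  last by rewrite big_map big_filter.
rewrite [RHS]fsbig_seq; last first.
  rewrite map_inj_uniq ?filter_uniq ?index_enum_uniq //.
  by move=> [x y] [x' y'] [] /emb_inj -> /emb_inj ->.
congr (\sum_(p \in _) F p); apply/seteqP; split => -[a b] /=.
  move=> e; have [v|x xa _] := @emb_surj m a.
    by apply: leq_trans (hc v); rewrite -e addfE leq_addr.
  have [v|y yb _] := @emb_surj m b.
    by apply: leq_trans (hc v); rewrite -e addfE leq_addl.
  apply/mapP; exists (x, y); rewrite /h /= ?xa ?yb //.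
  by rewrite mem_filter mem_index_enum /= xa yb e eqxx.
by move=> /mapP[[x y]]; rewrite mem_filter => /andP[/= /eqP <- _] [-> ->].
Qed.

Lemma sum_emb (R : nmodType) m c (F : {ffun V -> nat} -> R) : (forall v, c v <= m)%N ->
  \sum_(x : {ffun V -> 'I_m.+1} | emb x == c) F (emb x) = F c.
Proof.
move=> /emb_surj[x <- _]; rewrite (big_pred1 x) // => y.
by apply/eqP/eqP => [/emb_inj|->].
Qed.

End Box.

Section TwistedSeries.
Variables (R : realType) (q : R) (q_gt0 : 0 < q).
Variables (V : finType) (B : V -> V -> int).
Implicit Types (a b c : {ffun V -> nat}).

(* A formal series sum_a (f a) Z^a, where Z^a is the product of the Z_v ^+ a v
   taken in the order of [enum V] and Z_v Z_w = q ^ B v w Z_w Z_v.  The relations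
   let one reorder any word, so that Z^a Z^b = q ^ (twist a b) Z^(a + b), which
   determines the product of series.  The algebra presented by the Z_v is the
   subalgebra of finitely supported series: see [gen_comm] (its relations hold
   when B is skew-symmetric) and [mono_prod] (its ordered monomials are the basis
   [mono a]). *)
Record qseries (h : 0 < q) (C : V -> V -> int) :=
  QSeries { coef :> {ffun V -> nat} -> R }.

(* Z_v ^+ a v has to move past Z_w ^+ b w exactly when w precedes v. *)
Definition twist a b : int :=
  \sum_(v : V) \sum_(w : V | (enum_rank w < enum_rank v)%N)
     (a v * b w)%N%:Z * B v w.

Lemma twistDl a a' b : twist (a + a') b = twist a b + twist a' b.
Proof.
rewrite -big_split; apply: eq_bigr => v _ /=; rewrite -big_split; apply: eq_bigr => w _ /=.
by rewrite addfE mulnDl PoszD mulrDl.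
Qed.
Lemma twistDr a b b' : twist a (b + b') = twist a b + twist a b'.
Proof.
rewrite -big_split; apply: eq_bigr => v _ /=; rewrite -big_split; apply: eq_bigr => w _ /=.
by rewrite addfE mulnDr PoszD mulrDl.
Qed.
Lemma twist0l b : twist 0 b = 0.
Proof. by apply: big1 => v _; apply: big1 => w _; rewrite ffunE mul0n mul0r. Qed.
Lemma twist0r b : twist b 0 = 0.
Proof. by apply: big1 => v _; apply: big1 => w _; rewrite ffunE muln0 mul0r. Qed.

Local Notation S := (qseries q_gt0 B).

Lemma qseriesP (f g : S) : (forall a, f a = g a) -> f = g.
Proof. by case: f g => f [g] /= /funext ->. Qed.

HB.instance Definition _ := gen_eqMixin S.
HB.instance Definition _ := gen_choiceMixin S.

Definition qzero : S := QSeries _ _ (fun=> 0).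
Definition qopp (f : S) : S := QSeries _ _ (fun a => - f a).
Definition qadd (f g : S) : S := QSeries _ _ (fun a => f a + g a).
Definition qscale (t : R) (f : S) : S := QSeries _ _ (fun a => t * f a).

Lemma qaddA : associative qadd.
Proof. by move=> f g h; apply/qseriesP => a /=; rewrite addrA. Qed.
Lemma qaddC : commutative qadd.
Proof. by move=> f g; apply/qseriesP => a /=; rewrite addrC. Qed.
Lemma qadd0 : left_id qzero qadd.
Proof. by move=> f; apply/qseriesP => a /=; rewrite add0r. Qed.
Lemma qaddN : left_inverse qzero qopp qadd.
Proof. by move=> f; apply/qseriesP => a /=; rewrite addNr. Qed.
HB.instance Definition _ := GRing.isZmodule.Build S qaddA qaddC qadd0 qaddN.

Lemma qscaleA t u f : qscale t (qscale u f) = qscale (t * u) f.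
Proof. by apply/qseriesP => a /=; rewrite mulrA. Qed.
Lemma qscale1 : left_id 1 qscale.
Proof. by move=> f; apply/qseriesP => a /=; rewrite mul1r. Qed.
Lemma qscaleDr : right_distributive qscale +%R.
Proof. by move=> t f g; apply/qseriesP => a /=; rewrite mulrDr. Qed.
Lemma qscaleDl f : {morph qscale^~ f : t u / t + u}.
Proof. by move=> t u; apply/qseriesP => a /=; rewrite mulrDl. Qed.
HB.instance Definition _ :=
  GRing.Zmodule_isLmodule.Build R S qscaleA qscale1 qscaleDr qscaleDl.

Definition mono a : S := QSeries _ _ (fun c => (c == a)%:R).

Lemma monoE a c : mono a c = (c == a)%:R. Proof. by []. Qed.

Definition qmul (f g : S) : S := QSeries _ _ (fun c =>
  \sum_(p \in [set p : {ffun V -> nat} * {ffun V -> nat} | p.1 + p.2 = c]%classic)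
     (f p.1 * g p.2 * q ^ twist p.1 p.2)).

Lemma qaddE (f g : S) c : (f + g) c = f c + g c.
Proof. by []. Qed.
Lemma qscaleE (k : R) (f : S) c : (k *: f) c = k * f c.
Proof. by []. Qed.

Lemma qN0 : q != 0. Proof. exact: lt0r_neq0. Qed.

Lemma qmulE m (f g : S) c : (forall v, c v <= m)%N ->
  qmul f g c = \sum_(x : {ffun V -> 'I_m.+1}) 
   \sum_(y : {ffun V -> 'I_m.+1} | emb x + emb y == c)
    f (emb x) * g (emb y) * q ^ twist (emb x) (emb y).
Proof. exact: sum_split. Qed.

Lemma bnd c v : (c v <= \max_w c w)%N. Proof. exact: leq_bigmax. Qed.

Lemma qmulA : associative qmul.
Proof.
move=> f g h; apply/qseriesP => c; set m := \max_w c w.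
rewrite !(@qmulE m) //; try exact: bnd.
pose E3 (x y z : {ffun V -> 'I_m.+1}) := emb x + emb y + emb z == c.
pose W (x y z : {ffun V -> 'I_m.+1}) := f (emb x) * g (emb y) * h (emb z) *
   q ^ (twist (emb x) (emb y) + twist (emb x) (emb z) + twist (emb y) (emb z)).
transitivity (\sum_x \sum_y \sum_(z | E3 x y z) W x y z).
  apply: eq_bigr => x _.
  transitivity (\sum_(t : {ffun V -> 'I_m.+1} | emb x + emb t == c) \sum_y \sum_(z | emb y + emb z == emb t) W x y z).
    apply: eq_bigr => t /eqP tE; rewrite (@qmulE m); last first.
      by move=> v; rewrite ffunE -ltnS ltn_ord.
    rewrite mulr_sumr mulr_suml; apply: eq_bigr => y _.
    rewrite mulr_sumr mulr_suml; apply: eq_bigr => z /eqP <-.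
    by rewrite /W twistDr -!mulrA -!expfzDr ?qN0 // [twist (emb y) _ + _]addrC.
  rewrite exchange_big; apply: eq_bigr => y _.
  rewrite (exchange_big_dep predT) //= [RHS]big_mkcond; apply: eq_bigr => z _ /=.
  rewrite /E3 -addrA; case: eqP => [e|ne].
    have hb v : ((emb y + emb z)%R v <= m)%N.
      by apply: leq_trans (bnd c v); rewrite -e [X in (_ <= X)%N]addfE leq_addl.
    rewrite -[RHS](sum_emb (fun=> W x y z) hb); apply: eq_bigl => t.
    by rewrite [RHS]eq_sym; case: (@eqP _ _ (emb t)) => [<-|]; rewrite ?andbF // e eqxx.
  by rewrite big_pred0 // => t; case: (@eqP _ _ (emb t)) => [<-|]; rewrite ?andbF // andbT; apply/eqP.
apply/esym; rewrite (exchange_big_dep predT) //.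
transitivity (\sum_z \sum_x \sum_(y | E3 x y z) W x y z); last first.
  rewrite exchange_big /=; apply: eq_bigr => x _.
  by rewrite [RHS](exchange_big_dep predT).
apply: eq_bigr => z _.
transitivity (\sum_(t : {ffun V -> 'I_m.+1} | emb t + emb z == c) \sum_x \sum_(y | emb x + emb y == emb t) W x y z).
  apply: eq_bigr => t /eqP tE; rewrite (@qmulE m); last first.
    by move=> v; rewrite ffunE -ltnS ltn_ord.
  rewrite !mulr_suml; apply: eq_bigr => x _.
  rewrite !mulr_suml; apply: eq_bigr => y /eqP <-.
  rewrite /W twistDl -!mulrA; congr (_ * (_ * _)).
  by rewrite mulrCA -expfzDr ?qN0 // addrA.
rewrite exchange_big; apply: eq_bigr => x _.
rewrite (exchange_big_dep predT) //= [RHS]big_mkcond; apply: eq_bigr => y _ /=.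
rewrite /E3; case: eqP => [e|ne].
  have hb v : ((emb x + emb y)%R v <= m)%N.
    by apply: leq_trans (bnd c v); rewrite -e [X in (_ <= X)%N]addfE leq_addr.
  rewrite -[RHS](sum_emb (fun=> W x y z) hb); apply: eq_bigl => t.
  by rewrite [RHS]eq_sym; case: (@eqP _ _ (emb t)) => [<-|]; rewrite ?andbF // e eqxx.
by rewrite big_pred0 // => t; case: (@eqP _ _ (emb t)) => [<-|]; rewrite ?andbF // andbT; apply/eqP.
Qed.

Lemma mono_mul a b : qmul (mono a) (mono b) = q ^ twist a b *: mono (a + b).
Proof.
apply/qseriesP => c; set m := \max_w (a + b + c)%R w.
have bm v : (a v + b v + c v <= m)%N by rewrite -!addfE; exact: bnd.
rewrite (@qmulE m); last first.
  by move=> v; apply: leq_trans (bm v); rewrite leq_addl.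
under eq_bigr do rewrite big_mkcond.
pose F (u v : {ffun V -> nat}) : R := if u + v == c then q ^ twist u v else 0.
transitivity (\sum_(x : {ffun V -> 'I_m.+1} | emb x == a)
               \sum_(y : {ffun V -> 'I_m.+1} | emb y == b) F (emb x) (emb y)).
  rewrite [RHS]big_mkcond; apply: eq_bigr => x _.
  rewrite !monoE; case: eqP => xa; last by rewrite big1 // => y _; rewrite !mul0r if_same.
  rewrite [RHS]big_mkcond; apply: eq_bigr => y _; rewrite mul1r monoE /F.
  by case: (emb y == b); rewrite ?mul1r ?mul0r ?if_same.
rewrite (sum_emb (fun u => \sum_(y : {ffun V -> 'I_m.+1} | emb y == b) F u (emb y))); last first.
  by move=> v; apply: leq_trans (bm v); rewrite -addnA leq_addr.
rewrite (sum_emb (F a)); last first.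
  by move=> v; apply: leq_trans (bm v); rewrite addnAC leq_addl.
transitivity (q ^ twist a b * (c == a + b)%:R) => //; rewrite /F eq_sym.
by case: (c == a + b); rewrite ?mulr1 ?mulr0.
Qed.

Lemma qmul1r : left_id (mono 0) qmul.
Proof.
move=> f; apply/qseriesP => c; set m := \max_w c w.
rewrite (@qmulE m); last exact: bnd.
transitivity (\sum_(x : {ffun V -> 'I_m.+1} | emb x == 0)
               \sum_(y : {ffun V -> 'I_m.+1} | emb x + emb y == c) f (emb y) * q ^ twist (emb x) (emb y)).
  rewrite [RHS]big_mkcond; apply: eq_bigr => x _.
  rewrite !monoE; case: eqP => xa; last by rewrite big1 // => y _; rewrite !mul0r.
  by apply: eq_bigr => y _; rewrite mul1r.
rewrite (sum_emb (fun u => \sum_(y : {ffun V -> 'I_m.+1} | u + emb y == c) f (emb y) * q ^ twist u (emb y))); last by move=> v; rewrite ffunE.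
rewrite -[RHS](@sum_emb _ _ m c f); last exact: bnd.
by apply: eq_big => y; rewrite ?add0r // => _; rewrite twist0l mulr1.
Qed.

Lemma qmulr1 : right_id (mono 0) qmul.
Proof.
move=> f; apply/qseriesP => c; set m := \max_w c w.
rewrite (@qmulE m); last exact: bnd.
rewrite (exchange_big_dep predT) //.
transitivity (\sum_(y : {ffun V -> 'I_m.+1} | emb y == 0)
               \sum_(x : {ffun V -> 'I_m.+1} | emb x + emb y == c) f (emb x) * q ^ twist (emb x) (emb y)).
  rewrite [RHS]big_mkcond; apply: eq_bigr => x _.
  rewrite !monoE; case: eqP => xa; last by rewrite big1 // => y _; rewrite mulr0 mul0r.
  by apply: eq_bigr => y _; rewrite mulr1.
rewrite (sum_emb (fun u => \sum_(x : {ffun V -> 'I_m.+1} | emb x + u == c) f (emb x) * q ^ twist (emb x) u)); last by move=> v; rewrite ffunE.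
rewrite -[RHS](@sum_emb _ _ m c f); last exact: bnd.
by apply: eq_big => y; rewrite ?addr0 // => _; rewrite twist0r mulr1.
Qed.

Lemma qmulDl : left_distributive qmul +%R.
Proof.
move=> f g h; apply/qseriesP => c; rewrite qaddE.
rewrite !(qmulE _ _ (@bnd c)) -big_split; apply: eq_bigr => x _.
by rewrite -big_split; apply: eq_bigr => y _; rewrite qaddE !mulrDl.
Qed.

Lemma qmulDr : right_distributive qmul +%R.
Proof.
move=> f g h; apply/qseriesP => c; rewrite qaddE.
rewrite !(qmulE _ _ (@bnd c)) -big_split; apply: eq_bigr => x _.
by rewrite -big_split; apply: eq_bigr => y _; rewrite qaddE mulrDr mulrDl.
Qed.

Lemma mono0_neq0 : mono 0 != 0.
Proof.
by apply/eqP => /(congr1 (fun f : S => f 0)) /eqP; rewrite !monoE eqxx oner_eq0.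
Qed.

HB.instance Definition _ :=
  GRing.Zmodule_isNzRing.Build S qmulA qmul1r qmulr1 qmulDl qmulDr mono0_neq0.

Lemma mulq_coef (f g : S) c : (f * g) c =
  \sum_(p \in [set p : {ffun V -> nat} * {ffun V -> nat} | p.1 + p.2 = c]%classic)
     (f p.1 * g p.2 * q ^ twist p.1 p.2).
Proof. by []. Qed.
Lemma mulqE (f g : S) : f * g = qmul f g. Proof. by []. Qed.

Lemma qscaleAl (k : R) (f g : S) : k *: (f * g) = (k *: f) * g.
Proof.
apply/qseriesP => c; rewrite qscaleE !mulqE.
rewrite !(qmulE _ _ (@bnd c)) [LHS]mulr_sumr; apply: eq_bigr => x _.
by rewrite mulr_sumr; apply: eq_bigr => y _; rewrite qscaleE !mulrA.
Qed.
Lemma qscaleAr (k : R) (f g : S) : k *: (f * g) = f * (k *: g).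
Proof.
apply/qseriesP => c; rewrite qscaleE !mulqE.
rewrite !(qmulE _ _ (@bnd c)) [LHS]mulr_sumr; apply: eq_bigr => x _.
by rewrite mulr_sumr; apply: eq_bigr => y _; rewrite qscaleE !mulrA [f _ * k]mulrC.
Qed.
HB.instance Definition _ := GRing.Lmodule_isLalgebra.Build R S qscaleAl.
HB.instance Definition _ := GRing.Lalgebra_isAlgebra.Build R S qscaleAr.

Lemma oneqE : 1 = mono 0 :> S. Proof. by []. Qed.

Lemma mulmono a b : mono a * mono b = q ^ twist a b *: mono (a + b).
Proof. exact: mono_mul. Qed.

(* Coefficientwise sum of a family of series; [\sum_(i \in A)] is the sum over the
   support of the summand in A, with the junk value 0 if that support is infinite. *)
Definition fsum (I : choiceType) (F : I -> S) : S :=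
  QSeries _ _ (fun c => \sum_(i \in [set: I]%classic) F i c).

Lemma fsumE (I : choiceType) (F : I -> S) c :
  fsum F c = \sum_(i \in [set: I]%classic) F i c.
Proof. by []. Qed.

Definition delta (v : V) : {ffun V -> nat} := [ffun w => (w == v) : nat].
Definition gen (v : V) : S := mono (delta v).

(* Meaningful for x without constant term: by [qexp_coef] the coefficientwise sums
   are then finite. *)
Definition qexp (x : S) : S :=
  fsum (fun n : nat => (\prod_(1 <= k < n.+1) (1 - q ^+ k))^-1 *: (- x) ^+ n).

Lemma exp_low (x : S) n c : x 0 = 0 -> (\sum_v c v < n)%N -> (x ^+ n) c = 0.
Proof.
move=> x0; elim: n c => // n IH c hc; rewrite exprS mulq_coef.
apply: fsbig1 => -[a b] e; have {}e : a + b = c := e.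
rewrite ![(_, _).1]/= ![(_, _).2]/=.
have [->|ne] := eqVneq a 0; first by rewrite x0 !mul0r.
rewrite (IH b) ?mulr0 ?mul0r //; rewrite ltnS in hc; apply: leq_trans hc.
rewrite -e; under [X in (_ < X)%N]eq_bigr do rewrite addfE.
rewrite big_split /= -[ltnLHS]add0n ltn_add2r lt0n sum_nat_eq0.
apply: contra ne => /forallP h; apply/eqP/ffunP => v.
by rewrite [RHS]ffunE; apply/eqP; exact: h.
Qed.

Lemma qexp_coef (x : S) c : x 0 = 0 ->
  qexp x c = \sum_(n < (\sum_v c v).+1)
    (\prod_(1 <= k < n.+1) (1 - q ^+ k))^-1 * ((- x) ^+ n) c.
Proof.
move=> x0; rewrite /qexp fsumE (fsbigE (iota 0 (\sum_v c v).+1)) ?iota_uniq //.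
- rewrite -[RHS](big_mkord predT (fun n => (\prod_(1 <= k < n.+1) (1 - q ^+ k))^-1 * ((- x) ^+ n) c)).
  rewrite /index_iota subn0; apply: eq_bigl => n; exact: in_setT.
- move=> n _; rewrite mem_iota /= -leqNgt => hn.
  change (((\prod_(1 <= k < n.+1) (1 - q ^+ k))^-1 *: (- x) ^+ n : S) c = 0).
  rewrite qscaleE exp_low ?mulr0 //.
  by change (- x 0 = 0); rewrite x0 oppr0.
Qed.

(* The extension of Z_v |-> z v, as a homomorphism (resp. an anti-homomorphism, which
   reverses the ordered monomials), to formal series.  That it is one is proved in
   [alg_extM] (resp. [antialg_extM]) when z permutes the generators compatibly
   with B. *)
Definition alg_ext (z : V -> S) (f : S) : S :=
  fsum (fun a => f a *: \prod_(v <- enum V) z v ^+ a v).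
Definition antialg_ext (z : V -> S) (f : S) : S :=
  fsum (fun a => f a *: \prod_(v <- rev (enum V)) z v ^+ a v).

Lemma twistMl a b n : twist (a *+ n) b = twist a b *+ n.
Proof. by elim: n => [|n IH]; rewrite ?mulr0n ?twist0l // !mulrS twistDl IH. Qed.
Lemma twistMr a b n : twist a (b *+ n) = twist a b *+ n.
Proof. by elim: n => [|n IH]; rewrite ?mulr0n ?twist0r // !mulrS twistDr IH. Qed.

Lemma twist_delta v w : twist (delta v) (delta w) =
  if (enum_rank w < enum_rank v)%N then B v w else 0.
Proof.
rewrite /twist (bigD1 v) //= [X in _ + X]big1 ?addr0; last first.
  by move=> i ne; apply: big1 => j _; rewrite !ffunE (negPf ne) mul0n mul0r.
rewrite big_mkcond (bigD1 w) //= [X in _ + X]big1 ?addr0; last first.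
  by move=> i ne; rewrite !ffunE (negPf ne) muln0 mul0r if_same.
by rewrite !ffunE !eqxx mul1r.
Qed.

Lemma gen_exp v n : gen v ^+ n = mono (delta v *+ n).
Proof.
elim: n => [|n IH]; first by rewrite expr0 mulr0n.
by rewrite exprS IH mulmono twistMr twist_delta ltnn mul0rn expr0z scale1r mulrS.
Qed.

Lemma gen_comm : (forall v w, B v w = - B w v) -> forall v w,
  gen v * gen w = q ^ B v w *: (gen w * gen v).
Proof.
move=> Bskew v w; rewrite !mulmono scalerA -expfzDr ?qN0 // !twist_delta [delta w + _]addrC.
congr (q ^ _ *: _).
case: ltngtP; rewrite ?addr0 ?add0r //; first by rewrite Bskew addNr.
by move=> /val_inj/enum_rank_inj ->; have := Bskew v v; lia.
Qed.

Lemma pairwise_enum : pairwise (fun v w : V => (enum_rank v < enum_rank w)%N) (enum V).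
Proof.
case: (pickP (@predT V)) => [x0 _|V0]; last by rewrite (eq_enum V0) enum0.
apply/(pairwiseP x0) => i j; rewrite !inE -!cardE => hi hj ij.
by rewrite -(enum_val_nth x0 (Ordinal hi)) -(enum_val_nth x0 (Ordinal hj)) !enum_valK.
Qed.

Lemma prod_mono (z : V -> V) (s : seq V) a : {e : int |
  \prod_(v <- s) gen (z v) ^+ a v = q ^ e *: mono (\sum_(v <- s) delta (z v) *+ a v)}.
Proof.
elim: s => [|v s [e IH]]; first by exists 0; rewrite !big_nil scale1r.
rewrite !big_cons IH gen_exp -scalerAr mulmono scalerA -expfzDr ?qN0 //.
by eexists.
Qed.

Lemma sum_delta a : \sum_(v <- enum V) delta v *+ a v = a.
Proof.
apply/ffunP => w; rewrite sum_ffunE big_enum /= (bigD1 w) //= [X in _ + X]big1 ?addr0.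
  by rewrite ffunMnE ffunE eqxx; apply: natn.
by move=> v ne; rewrite ffunMnE ffunE eq_sym (negPf ne) mul0rn.
Qed.

Lemma mono_prod a : mono a = \prod_(v <- enum V) gen v ^+ a v.
Proof.
rewrite -{1}[a]sum_delta; elim: (enum V) pairwise_enum => [|v s IH]; first by rewrite !big_nil.
rewrite pairwise_cons => /andP[/allP hv hs]; rewrite !big_cons -IH // gen_exp mulmono.
rewrite twistMl [twist _ _](_ : _ = 0) ?mul0rn ?scale1r //.
elim: s hv {IH hs} => [|w s IH] hv; rewrite ?big_nil ?twist0r // big_cons twistDr twistMr twist_delta.
rewrite ltnNge ltnW ?hv ?mem_head // mul0rn add0r IH // => x xs; apply: hv.
by rewrite inE xs orbT.
Qed.

Lemma exp_comm (A : algType R) (x y : A) (t : int) m n :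
  x * y = q ^ t *: (y * x) ->
  x ^+ m * y ^+ n = q ^ ((m * n)%N%:Z * t) *: (y ^+ n * x ^+ m).
Proof.
move=> h.
have h1 k : x * y ^+ k = q ^ (k%:Z * t) *: (y ^+ k * x).
  elim: k => [|k IH]; first by rewrite mul0r expr0z scale1r expr0 mulr1 mul1r.
  rewrite exprS mulrA h -scalerAl -[y * x * _]mulrA IH -scalerAr scalerA mulrA -expfzDr ?qN0 //.
  by congr (q ^ _ *: _); rewrite intS mulrDl mul1r.
elim: m => [|k IH]; first by rewrite mul0n mul0r expr0z scale1r mul1r mulr1.
rewrite exprS -mulrA IH -scalerAr [x * (y ^+ n * _)]mulrA h1 -scalerAl scalerA -[_ * x * _]mulrA -expfzDr ?qN0 //.
by congr (q ^ _ *: _); rewrite mulSn PoszD; ring.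
Qed.

Lemma prod_delta (A : pzRingType) (z : V -> A) (s : seq V) v :
  uniq s -> v \in s -> \prod_(w <- s) z w ^+ delta v w = z v.
Proof.
elim: s => //= x s IH /andP[xs us]; rewrite inE big_cons ffunE eq_sym.
case: eqP => [vx _|_ /= vs]; last by rewrite expr0 mul1r IH.
rewrite big_seq big1 ?mulr1 ?vx // => w ws; rewrite ffunE.
by case: eqP => // wx; rewrite vx -wx ws in xs.
Qed.

Section NormalOrder.
Variables (A : algType R) (z : V -> A) (C : V -> V -> int) (lt : rel V).
Hypothesis zC : forall v w, z v * z w = q ^ C v w *: (z w * z v).
Hypothesis lt_asym : forall v w, lt v w -> lt w v = false.

Lemma normal_order1 (s : seq V) a x n :
  (\prod_(v <- s) z v ^+ a v) * z x ^+ n =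
   q ^ (\sum_(v <- s) (a v * n)%N%:Z * C v x) *: (z x ^+ n * \prod_(v <- s) z v ^+ a v).
Proof.
elim: s => [|v s IH]; first by rewrite !big_nil expr0z scale1r mulr1 mul1r.
rewrite !big_cons -mulrA IH -scalerAr [_ * (z x ^+ n * _)]mulrA (exp_comm _ _ (zC v x)) -scalerAl scalerA mulrA.
by rewrite -expfzDr ?qN0 // addrC.
Qed.

Lemma normal_order (s : seq V) a b : pairwise lt s ->
  (\prod_(v <- s) z v ^+ a v) * (\prod_(v <- s) z v ^+ b v) =
  q ^ (\sum_(v <- s) \sum_(w <- s | lt w v) (a v * b w)%N%:Z * C v w) *:
  \prod_(v <- s) z v ^+ (a + b)%R v.
Proof.
elim: s => [|x s IH]; first by rewrite !big_nil expr0z scale1r mulr1.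
rewrite pairwise_cons => /andP[/allP hx hs]; rewrite !big_cons.
rewrite -mulrA [X in _ * X]mulrA normal_order1 -scalerAl -scalerAr -!mulrA IH //.
rewrite -!scalerAr scalerA !mulrA -exprD addfE -expfzDr ?qN0 //.
congr (q ^ _ *: _).
have lxx : lt x x = false by apply/negP => h; move: (h); rewrite lt_asym.
rewrite lxx [X in _ = X + _]big_seq_cond [X in _ = X + _]big1 ?add0r; last first.
  by move=> w /andP[/hx/lt_asym ->].
rewrite -big_split /= !big_seq; apply: eq_bigr => v vs.
by rewrite big_cons hx.
Qed.
End NormalOrder.


Section Extension.
Variable s : V -> V.
Hypothesis s_inj : injective s.

Definition pull a : {ffun V -> nat} := [ffun v => a (s v)].
Definition push a : {ffun V -> nat} := [ffun v => a (invF s_inj v)].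

Lemma pushK : cancel push pull.
Proof. by move=> a; apply/ffunP => v; rewrite !ffunE invF_f. Qed.
Lemma pullK : cancel pull push.
Proof. by move=> a; apply/ffunP => v; rewrite !ffunE f_invF. Qed.
Lemma pushD a b : push (a + b) = push a + push b.
Proof. by apply/ffunP => v; rewrite !ffunE. Qed.

Lemma push_sum a : \sum_(v <- enum V) delta (s v) *+ a v = push a.
Proof.
rewrite -{2}[a]sum_delta; elim: (enum V) => [|v t IH].
  by rewrite !big_nil; apply/ffunP => w; rewrite !ffunE.
rewrite !big_cons pushD IH; congr (_ + _); apply/ffunP => w.
by rewrite !(ffunMnE, ffunE) -[invF _ _ == v](inj_eq s_inj) f_invF.
Qed.

Section Normal.
Variables (P : {ffun V -> nat} -> S).
Hypothesis P_mono : forall a, {e : int | P a = q ^ e *: mono (push a)}.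

Let k a : R := P a (push a).
Lemma PE a : P a = k a *: mono (push a).
Proof.
rewrite /k; have [e ->] := P_mono a.
by rewrite qscaleE !monoE eqxx mulr1.
Qed.

Lemma extE (f : S) c : fsum (fun a => f a *: P a) c = f (pull c) * k (pull c).
Proof.
rewrite fsumE -(fsbig_widen [set pull c]) //; last first.
  move=> a [_ ne]; change ((f a *: P a) c = 0); rewrite qscaleE PE qscaleE monoE.
  case: eqP => [e|_]; last by rewrite !mulr0.
  by case: ne; rewrite e pushK.
by rewrite fsbig_set1 qscaleE PE qscaleE !monoE pullK eqxx mulr1.
Qed.

Lemma ext_mono a : fsum (fun b => mono a b *: P b) = P a.
Proof.
apply/qseriesP => c; rewrite extE PE qscaleE !monoE (can2_eq pullK pushK).
by case: eqP => [->|]; rewrite ?mul0r ?mulr0 // pushK mulr1 mul1r.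
Qed.

Lemma reindex_pull c (F : _ -> R) :
  \sum_(p \in [set p : {ffun V -> nat} * {ffun V -> nat} | p.1 + p.2 = pull c]%classic) F p
  = \sum_(p \in [set p : {ffun V -> nat} * {ffun V -> nat} | p.1 + p.2 = c]%classic)
      F (pull p.1, pull p.2).
Proof.
apply: (reindex_fsbig (fun p : {ffun V -> nat} * {ffun V -> nat} => (pull p.1, pull p.2))).
split.
- by move=> [a b] /= <-; apply/ffunP => v; rewrite !ffunE.
- by move=> [a b] [a' b'] _ _ [] /(can_inj pullK) -> /(can_inj pullK) ->.
- move=> [a b] /= e; exists (push a, push b); rewrite /= ?pushK //.
  by rewrite -pushD e pullK.
Qed.

Lemma swap_split c (F : _ -> R) :
  \sum_(p \in [set p : {ffun V -> nat} * {ffun V -> nat} | p.1 + p.2 = c]%classic) F p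
  = \sum_(p \in [set p : {ffun V -> nat} * {ffun V -> nat} | p.1 + p.2 = c]%classic)
      F (p.2, p.1).
Proof.
apply: (reindex_fsbig (fun p : {ffun V -> nat} * {ffun V -> nat} => (p.2, p.1))).
split.
- by move=> [a b] /= <-; rewrite addrC.
- by move=> [a b] [a' b'] _ _ [] -> ->.
- by move=> [a b] /= e; exists (b, a); rewrite //= addrC.
Qed.

Let ext (f : S) : S := fsum (fun a => f a *: P a).

Lemma ext_morph (f g : S) :
  (forall a b, P a * P b = q ^ twist a b *: P (a + b)) -> ext (f * g) = ext f * ext g.
Proof.
move=> PM; apply/qseriesP => c; rewrite /ext extE !mulq_coef reindex_pull mulr_fsuml.
apply: eq_fsbigr => -[a b] /set_mem e.
have {}e : a + b = c := e; rewrite ![(_, _).1]/= ![(_, _).2]/= !extE.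
rewrite [X in _ = X * _]mulrACA -!mulrA; congr (_ * (_ * _)).
have := congr1 (fun f : S => f c) (PM (pull a) (pull b)).
rewrite !PE -scalerAl -scalerAr mulmono !qscaleE !pushD !pullK !monoE e eqxx !mulr1 => ->.
by congr (_ * k _); rewrite -e; apply/ffunP => v; rewrite !ffunE.
Qed.

Lemma ext_antimorph (f g : S) :
  (forall a b, P b * P a = q ^ twist a b *: P (a + b)) -> ext (f * g) = ext g * ext f.
Proof.
move=> PM; apply/qseriesP => c; rewrite /ext extE !mulq_coef reindex_pull mulr_fsuml.
rewrite [RHS]swap_split; apply: eq_fsbigr => -[a b] /set_mem e.
have {}e : a + b = c := e; rewrite ![(_, _).1]/= ![(_, _).2]/= !extE.
rewrite [X in _ = X * _]mulrACA [g _ * f _]mulrC -!mulrA; congr (_ * (_ * _)).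
have := congr1 (fun f : S => f c) (PM (pull a) (pull b)).
rewrite !PE -scalerAl -scalerAr mulmono !qscaleE !pushD !pullK !monoE e [b + a]addrC e eqxx !mulr1.
rewrite mulrCA mulrA => ->.
by congr (_ * k _); rewrite -e; apply/ffunP => v; rewrite !ffunE.
Qed.

Lemma ext_linear t (f g : S) : ext (t *: f + g) = t *: ext f + ext g.
Proof. by apply/qseriesP => c; rewrite qaddE qscaleE /ext !extE qaddE qscaleE mulrDl mulrA. Qed.

End Normal.

Hypothesis Bskew : forall v w, B v w = - B w v.

Let fwd a := \prod_(v <- enum V) gen (s v) ^+ a v.
Let bwd a := \prod_(v <- rev (enum V)) gen (s v) ^+ a v.

Lemma fwd_mono a : {e : int | fwd a = q ^ e *: mono (push a)}.
Proof. by have [e] := prod_mono s (enum V) a; rewrite push_sum; exists e. Qed.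
Lemma bwd_mono a : {e : int | bwd a = q ^ e *: mono (push a)}.
Proof.
have [e h] := prod_mono s (rev (enum V)) a; exists e; rewrite /bwd h -push_sum.
by congr (_ *: mono _); apply: perm_big; rewrite perm_rev.
Qed.

Lemma alg_extM : (forall v w, B (s v) (s w) = B v w) ->
  {morph alg_ext (gen \o s) : f g / f * g}.
Proof.
move=> sB f g; apply: (ext_morph fwd_mono) => a b.
rewrite /fwd (normal_order (C := B) (lt := fun v w => (enum_rank v < enum_rank w)%N)).
- by congr (q ^ _ *: _); rewrite big_enum; apply: eq_bigr => v _; rewrite big_enum_cond.
- by move=> v w; rewrite gen_comm // sB.
- by move=> v w; lia.
- exact: pairwise_enum.
Qed.

Lemma antialg_extM : (forall v w, B (s v) (s w) = - B v w) ->
  forall f g, antialg_ext (gen \o s) (f * g) = antialg_ext (gen \o s) g * antialg_ext (gen \o s) f.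
Proof.
move=> sB f g; apply: (ext_antimorph bwd_mono) => a b.
rewrite /bwd (normal_order (C := fun v w => B w v) (lt := fun v w => (enum_rank w < enum_rank v)%N)).
- rewrite addrC; congr (q ^ _ *: _).
  have pe : perm_eq (rev (enum V)) (enum V) by rewrite perm_rev.
  rewrite (perm_big _ pe) big_enum /=.
  under eq_bigr do rewrite (perm_big _ pe) big_enum_cond /=.
  rewrite (exchange_big_dep predT) //=; apply: eq_bigr => v _.
  by apply: eq_bigr => w _; rewrite mulnC.
- move=> v w; rewrite gen_comm // sB Bskew opprK.
  by [].
- by move=> v w; lia.
- by rewrite pairwise_rev; apply: pairwise_enum.
Qed.

Lemma alg_ext_linear t (f g : S) : alg_ext (gen \o s) (t *: f + g) =
  t *: alg_ext (gen \o s) f + alg_ext (gen \o s) g.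
Proof. exact: (ext_linear fwd_mono). Qed.
Lemma antialg_ext_linear t (f g : S) : antialg_ext (gen \o s) (t *: f + g) =
  t *: antialg_ext (gen \o s) f + antialg_ext (gen \o s) g.
Proof. exact: (ext_linear bwd_mono). Qed.

Lemma alg_ext1 : alg_ext (gen \o s) 1 = 1.
Proof. 
rewrite [LHS](ext_mono fwd_mono) /fwd big1 // => v _.
by rewrite ffunE expr0.
Qed.
Lemma antialg_ext1 : antialg_ext (gen \o s) 1 = 1.
Proof. 
rewrite [LHS](ext_mono bwd_mono) /bwd big1 // => v _.
by rewrite ffunE expr0.
Qed.

Lemma alg_ext_gen v : alg_ext (gen \o s) (gen v) = gen (s v).
Proof.
rewrite [LHS](ext_mono fwd_mono).
by apply: (prod_delta (gen \o s)); rewrite ?enum_uniq ?mem_enum.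
Qed.
Lemma antialg_ext_gen v : antialg_ext (gen \o s) (gen v) = gen (s v).
Proof.
rewrite [LHS](ext_mono bwd_mono).
by apply: (prod_delta (gen \o s)); rewrite ?rev_uniq ?mem_rev ?enum_uniq ?mem_enum.
Qed.

End Extension.
End TwistedSeries.


Section Quiver.
Variables (R : realType) (q : R) (q_gt0 : 0 < q) (N : nat).

Definition vertex : Type := {p : 'I_N.+1 * 'I_N.+1 | (0 < p.1 < p.2)%N}.
HB.instance Definition _ := Finite.on vertex.
Implicit Types v w : vertex.

Definition vi v : nat := (val v).1.
Definition vj v : nat := (val v).2.

Definition edge v w : bool :=
  [|| (vi w == vi v) && (vj w == (vj v).+1),
      (vi w == (vi v).+1) && (vj w == vj v) |
      (vi v == (vi w).+1) && (vj v == (vj w).+1)].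

Definition incidence v w : int :=
  if edge v w then 1 else if edge w v then -1 else 0.

Local Notation That := (qseries q_gt0 incidence).

(* The junk value 0 is used when (i, j) is not a vertex. *)
Definition Zgen (i j : nat) : That :=
  if [pick v : vertex | (vi v == i) && (vj v == j)] is Some v
  then gen q_gt0 incidence v else 0.

Definition rho : That -> That :=
  alg_ext (fun v => Zgen (vj v - vi v) (N.+1 - vi v)).
Definition mu1 : That -> That :=
  antialg_ext (fun v => Zgen (vj v - vi v) (vj v)).
Definition mu2 : That -> That :=
  antialg_ext (fun v => Zgen (N.+1 - vj v) (N.+1 - vi v)).
Definition mu3 : That -> That :=
  antialg_ext (fun v => Zgen (vi v) (N.+1 + vi v - vj v)).

Definition Rfactor (a b c : nat) : That :=
  qexp (\prod_(0 <= k < c - b) Zgen (a + k) (b + k)).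

(* The nested products enumerate the triples a < b < c <= N + 1 in lexicographic
   order, the ranges being empty when there is no such triple. *)
Definition TN : That :=
  \prod_(1 <= a < N.+2) \prod_(a.+1 <= b < N.+2) \prod_(b.+1 <= c < N.+2)
    Rfactor a b c.

Lemma vertex_range v : (0 < vi v < vj v)%N && (vj v <= N)%N.
Proof. by rewrite /vi /vj (valP v) /= -ltnS ltn_ord. Qed.

Lemma vertex_inj v w : vi v = vi w -> vj v = vj w -> v = w.
Proof.
move=> hi hj; apply/val_inj; rewrite [val v]surjective_pairing [val w]surjective_pairing.
by congr (_, _); apply/val_inj.
Qed.

Lemma vertex_ex i j : (0 < i < j)%N && (j <= N)%N -> {v : vertex | vi v = i & vj v = j}.
Proof.
move=> h.
have hi : (i < N.+1)%N by lia.
have hj : (j < N.+1)%N by lia.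
have hv : (0 < (Ordinal hi, Ordinal hj).1 < (Ordinal hi, Ordinal hj).2)%N by rewrite /=; lia.
by exists (Sub (Ordinal hi, Ordinal hj) hv : vertex); rewrite /vi /vj SubK.
Qed.

Lemma Zgen_vertex v : Zgen (vi v) (vj v) = gen q_gt0 incidence v.
Proof.
rewrite /Zgen; case: pickP => [w /andP[/eqP hi /eqP hj]|/(_ v)]; last by rewrite !eqxx.
by rewrite (vertex_inj hi hj).
Qed.

Lemma incidence_skew v w : incidence v w = - incidence w v.
Proof.
rewrite /incidence; case: ifP => h1; case: ifP => h2; rewrite ?oppr0 ?opprK //.
by exfalso; move: h1 h2; rewrite /edge; lia.
Qed.

Lemma Zgen_comm v w :
  Zgen (vi v) (vj v) * Zgen (vi w) (vj w) =
  q ^ incidence v w *: (Zgen (vi w) (vj w) * Zgen (vi v) (vj v)).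
Proof. by rewrite !Zgen_vertex; apply: gen_comm; exact: incidence_skew. Qed.

Lemma vertex_map (fi fj : vertex -> nat) :
  (forall v, (0 < fi v < fj v)%N && (fj v <= N)%N) ->
  {s : vertex -> vertex | (forall v, vi (s v) = fi v /\ vj (s v) = fj v)
    & (fun v => Zgen (fi v) (fj v)) = gen q_gt0 incidence \o s}.
Proof.
move=> h; pose s v := s2val (vertex_ex (h v)).
have sE v : vi (s v) = fi v /\ vj (s v) = fj v.
  by split; rewrite /s; case: vertex_ex.
by exists s => //; apply/funext => v /=; have [<- <-] := sE v; rewrite Zgen_vertex.
Qed.

Lemma alg_ext_morphism (fi fj : vertex -> nat) (f := alg_ext (fun v => Zgen (fi v) (fj v))) :
  (forall v, (0 < fi v < fj v)%N && (fj v <= N)%N) ->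
  (forall v w, fi v = fi w -> fj v = fj w -> v = w) ->
  (forall s : vertex -> vertex, (forall v, vi (s v) = fi v /\ vj (s v) = fj v) ->
     forall v w, edge (s v) (s w) = edge v w) ->
  [/\ linear f, f 1 = 1, {morph f : x y / x * y} &
   forall v, f (Zgen (vi v) (vj v)) = Zgen (fi v) (fj v)].
Proof.
move=> hr hinj hB; rewrite /f; have [s sE ze] := vertex_map hr; rewrite ze.
have s_inj : injective s.
  by move=> v w e; apply: hinj; have [a b] := sE v; have [c d] := sE w; rewrite -?a -?b -?c -?d e.
split.
- by move=> t x y; apply: alg_ext_linear.
- exact: alg_ext1.
- apply: alg_extM => //; first exact: incidence_skew.
  by move=> v w; rewrite /incidence !(hB _ sE).
- by move=> v; rewrite Zgen_vertex alg_ext_gen // -Zgen_vertex; have [-> ->] := sE v.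
Qed.

Lemma antialg_ext_morphism (fi fj : vertex -> nat) (f := antialg_ext (fun v => Zgen (fi v) (fj v))) :
  (forall v, (0 < fi v < fj v)%N && (fj v <= N)%N) ->
  (forall v w, fi v = fi w -> fj v = fj w -> v = w) ->
  (forall s : vertex -> vertex, (forall v, vi (s v) = fi v /\ vj (s v) = fj v) ->
     forall v w, edge (s v) (s w) = edge w v) ->
  [/\ linear f, f 1 = 1, forall x y, f (x * y) = f y * f x &
   forall v, f (Zgen (vi v) (vj v)) = Zgen (fi v) (fj v)].
Proof.
move=> hr hinj hB; rewrite /f; have [s sE ze] := vertex_map hr; rewrite ze.
have s_inj : injective s.
  by move=> v w e; apply: hinj; have [a b] := sE v; have [c d] := sE w; rewrite -?a -?b -?c -?d e.
split.
- by move=> t x y; apply: antialg_ext_linear.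
- exact: antialg_ext1.
- apply: antialg_extM => //; first exact: incidence_skew.
  by move=> v w; rewrite -incidence_skew /incidence !(hB _ sE).
- by move=> v; rewrite Zgen_vertex antialg_ext_gen // -Zgen_vertex; have [-> ->] := sE v.
Qed.

Local Ltac ranges v w := have := vertex_range v; have := vertex_range w.

Lemma rho_morphism : [/\ linear rho, rho 1 = 1, {morph rho : x y / x * y} &
  forall v, rho (Zgen (vi v) (vj v)) = Zgen (vj v - vi v) (N.+1 - vi v)].
Proof.
apply: alg_ext_morphism => [v|v w|s sE v w].
- by have := vertex_range v; lia.
- by ranges v w => *; apply: vertex_inj; lia.
- ranges v w; have [] := sE v; have [] := sE w; rewrite /edge; lia.
Qed.

Lemma mu1_antimorphism : [/\ linear mu1, mu1 1 = 1, forall x y, mu1 (x * y) = mu1 y * mu1 x &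
  forall v, mu1 (Zgen (vi v) (vj v)) = Zgen (vj v - vi v) (vj v)].
Proof.
apply: antialg_ext_morphism => [v|v w|s sE v w].
- by have := vertex_range v; lia.
- by ranges v w => *; apply: vertex_inj; lia.
- ranges v w; have [] := sE v; have [] := sE w; rewrite /edge; lia.
Qed.

Lemma mu2_antimorphism : [/\ linear mu2, mu2 1 = 1, forall x y, mu2 (x * y) = mu2 y * mu2 x &
  forall v, mu2 (Zgen (vi v) (vj v)) = Zgen (N.+1 - vj v) (N.+1 - vi v)].
Proof.
apply: antialg_ext_morphism => [v|v w|s sE v w].
- by have := vertex_range v; lia.
- by ranges v w => *; apply: vertex_inj; lia.
- ranges v w; have [] := sE v; have [] := sE w; rewrite /edge; lia.
Qed.

Lemma mu3_antimorphism : [/\ linear mu3, mu3 1 = 1, forall x y, mu3 (x * y) = mu3 y * mu3 x &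
  forall v, mu3 (Zgen (vi v) (vj v)) = Zgen (vi v) (N.+1 + vi v - vj v)].
Proof.
apply: antialg_ext_morphism => [v|v w|s sE v w].
- by have := vertex_range v; lia.
- by ranges v w => *; apply: vertex_inj; lia.
- ranges v w; have [] := sE v; have [] := sE w; rewrite /edge; lia.
Qed.
End Quiver.

(* Main.v *)
(** Let V_i^n be the sum of all strings that end at the vertex (i, n).  The strings
    ending at a common vertex q-commute, so the product of their quantum exponentials
    is <V_i^n>_q; commuting factors past each other, T_N becomes C_1 C_2 ... C_N with
    C_n the ordered product of the <V_i^n>_q, and the same reordering gives
    mu2 T_N = T_N.

    The heart is the intertwining relation
      (C_1 ... C_n) V_i^(n+1) = U_i^(n+1) (C_1 ... C_n),  U_i^n = mu1 V_(n-i)^n.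
    It follows by induction on n from V_i^(n+1) = (1 + V_(i-1)^n) y,
    U_i^(n+1) = y (1 + U_i^n) with y = Z_{i,n+1}, and from
      <A><B> (1 + A) y = y (1 + B) <A><B>,  A = V_(i-1)^n, B = V_i^n,
    which is proved by adding the strings of B and of A one at a time.  Exponentiated,
    the relation says (C_1 ... C_n) C_(n+1) = mu1 (C_(n+1)) (C_1 ... C_n), whence
    mu1 T_N = T_N by induction.  The rest is formal: rho, mu1 o mu2 and mu3 o mu1 are
    continuous homomorphisms that agree on the generators. *)

Require Import Defs.
From mathcomp Require Import all_boot all_order all_algebra.
From mathcomp Require Import fsbigop.
From mathcomp Require Import reals.
From mathcomp Require Import zify ring.
Set Implicit Arguments.
Unset Strict Implicit.
Unset Printing Implicit Defensive.
Import Order.TTheory GRing.Theory Num.Theory.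
Local Open Scope ring_scope.

(** * Reordering noncommutative products, and sorted enumerations *)

Lemma prod_reorder (A : pzSemiRingType) (I : eqType) (F : I -> A)
    (lt1 lt2 : rel I) (s t : seq I) :
  pairwise lt1 s -> pairwise lt2 t -> uniq s -> perm_eq s t ->
  (forall x y, x \in s -> y \in s -> lt1 x y -> lt2 y x -> F x * F y = F y * F x) ->
  \prod_(x <- s) F x = \prod_(x <- t) F x.
Proof.
elim: s t => [|x s IH] t; first by move=> _ _ _; rewrite perm_sym => /perm_nilP ->.
move=> /= /andP[/allP xs ps] pt /andP[xns us] pst hc.
have xt : x \in t by rewrite -(perm_mem pst) mem_head.
case/path.splitPr: t / xt pt pst => t1 t2 pt pst.
have pst' : perm_eq s (t1 ++ t2).
  rewrite -(perm_cons x); apply: (perm_trans pst); apply/permPl.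
  exact: (perm_catCA t1 [:: x] t2).
have xt1 y : y \in t1 -> y \in s by move=> yt; rewrite (perm_mem pst') mem_cat yt.
move: pt; rewrite pairwise_cat /= => /and3P[/allrelP h12 pt1 /andP[_ pt2]].
(* Whatever [t] puts before [x] comes after [x] in [s], so each such pair is inverted and [hc] lets
   [F x] move to the front. *)
have cx : GRing.comm (F x) (\prod_(y <- t1) F y).
  rewrite big_seq; apply: commr_prod => y yt.
  apply: hc; rewrite ?mem_head ?inE ?xt1 ?orbT //; first exact: xs (xt1 _ yt).
  by apply: h12; rewrite ?mem_head.
rewrite big_cat !big_cons /= mulrA -cx -mulrA; congr (_ * _); rewrite -big_cat; apply: IH => //.
  rewrite pairwise_cat pt1 pt2 !andbT; apply/allrelP => y z yt zt.
  by apply: h12; rewrite ?inE ?zt ?orbT.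
by move=> y z ys zs; apply: hc; rewrite inE ?ys ?zs orbT.
Qed.

Lemma antimorph_prod_rev (A A' : pzSemiRingType) (I : Type) (phi : A -> A') (s : seq I)
    (F : I -> A) :
  phi 1 = 1 -> (forall x y, phi (x * y) = phi y * phi x) ->
  phi (\prod_(i <- s) F i) = \prod_(i <- rev s) phi (F i).
Proof.
move=> phi1 phiM; elim: s => [|i s IH]; first by rewrite !big_nil.
by rewrite big_cons phiM IH rev_cons big_rcons.
Qed.

Lemma antimorph_prod_nat (A A' : pzSemiRingType) (phi : A -> A') (F : nat -> A) n :
  phi 1 = 1 -> (forall x y, phi (x * y) = phi y * phi x) ->
  phi (\prod_(0 <= i < n) F i) = \prod_(0 <= i < n) phi (F (n - i.+1)%N).
Proof.
move=> phi1 phiM; elim: n => [|n IH]; first by rewrite !big_geq.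
by rewrite big_nat_recr //= phiM IH big_nat_recl //= subn1.
Qed.

Lemma pairwise_allpairs (I J K : eqType) (f : I -> J -> K) (s : seq I) (t : I -> seq J)
    (rI : rel I) (rJ : rel J) (r : rel K) :
  pairwise rI s -> (forall x, x \in s -> pairwise rJ (t x)) ->
  (forall x x' y y', x \in s -> x' \in s -> y \in t x -> y' \in t x' ->
     rI x x' -> r (f x y) (f x' y')) ->
  (forall x y y', x \in s -> y \in t x -> y' \in t x -> rJ y y' -> r (f x y) (f x y')) ->
  pairwise r [seq f x y | x <- s, y <- t x].
Proof.
elim: s => //= x s IH /andP[/allP xs ps] pt hI hJ.
have hin z : z \in s -> z \in x :: s by move=> zs; rewrite inE zs orbT.
rewrite pairwise_cat; apply/and3P; split.
- apply/allrelP => _ _ /mapP[y yt ->] /allpairsPdep[x' [y' [x's y't ->]]].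
  by apply: hI; rewrite ?mem_head ?hin ?xs.
- rewrite pairwise_map; apply: (sub_in_pairwise _ (allss _) (pt x (mem_head _ _))).
  by move=> y y' ty ty' h; apply: hJ; rewrite ?mem_head.
- apply: IH => //.
  + by move=> z zs; apply: pt; apply: hin.
  + by move=> z z' y y' zs zs' *; apply: hI; rewrite ?hin.
  + by move=> z y y' zs *; apply: hJ; rewrite ?hin.
Qed.

Lemma pairwise_index_iota m n : pairwise ltn (index_iota m n).
Proof. by rewrite -sorted_pairwise ?iota_ltn_sorted //; apply: ltn_trans. Qed.

Lemma triangle_sum (W : nmodType) (F : nat -> nat -> W) M :
  \sum_(i < M) \sum_(j < M - i) F i j = \sum_(n < M) \sum_(k < n.+1) F k (n - k)%N.
Proof.
elim: M => [|M IH]; first by rewrite !big_ord0.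
rewrite [RHS]big_ord_recr -IH big_ord_recr /= subSnn big_ord1.
rewrite [X in _ = _ + X]big_ord_recr /= subnn addrA; congr (_ + _).
rewrite -big_split; apply: eq_bigr => i _ /=.
by rewrite subSn ?big_ord_recr // ltnW.
Qed.

(** * The degree filtration and the quantum exponential *)

Section Qexp.
Variables (R : realType) (q : R) (q_gt0 : 0 < q).
Variables (V : finType) (B : V -> V -> int).
Local Notation S := (qseries q_gt0 B).
Implicit Types (f g x y z : S) (c : {ffun V -> nat}).

(** This filtration by total degree takes the place of a topology on the series: by [lowdeg_eq], an
    identity may be checked modulo [lowdeg M] for every [M], where exponentials become finite
    sums. *)
Definition lowdeg M f := forall c, (\sum_v c v < M)%N -> f c = 0.
Arguments lowdeg : simpl never.

Lemma lowdegD M f g : lowdeg M f -> lowdeg M g -> lowdeg M (f + g).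
Proof. by move=> hf hg c hc; rewrite qaddE hf ?hg ?addr0. Qed.

Lemma lowdegN M f : lowdeg M f -> lowdeg M (- f).
Proof. by move=> hf c /hf h; change (- f c = 0); rewrite h oppr0. Qed.

Lemma lowdegZ M k f : lowdeg M f -> lowdeg M (k *: f).
Proof. by move=> hf c hc; rewrite qscaleE hf ?mulr0. Qed.

Lemma lowdeg_sum M (I : Type) (r : seq I) (P : pred I) (F : I -> S) :
  (forall i, P i -> lowdeg M (F i)) -> lowdeg M (\sum_(i <- r | P i) F i).
Proof. by move=> h; apply: (big_ind (lowdeg M)) => // f g; apply: lowdegD. Qed.

Lemma lowdegM M M' f g : lowdeg M f -> lowdeg M' g -> lowdeg (M + M') (f * g).
Proof.
move=> hf hg c hc; rewrite mulq_coef; apply: fsbig1 => -[a b] e.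
have {}e : a + b = c := e; rewrite ![(_, _).1]/= ![(_, _).2]/=.
have [ha|ha] := ltnP (\sum_v a v) M; first by rewrite hf ?mul0r.
rewrite [g b]hg ?mulr0 ?mul0r //.
move: hc; rewrite -e; under eq_bigr do rewrite addfE.
rewrite big_split /= => hc; rewrite -(ltn_add2l M); apply: leq_ltn_trans hc.
by rewrite leq_add2r.
Qed.

Lemma lowdegl M f g : lowdeg M f -> lowdeg M (f * g).
Proof. by move=> hf; rewrite -[M]addn0; apply: lowdegM. Qed.

Lemma lowdegr M f g : lowdeg M g -> lowdeg M (f * g).
Proof. by move=> hf; rewrite -[M]add0n; apply: lowdegM. Qed.

Lemma lowdegX x n : lowdeg 1 x -> lowdeg n (x ^+ n).
Proof.
by move=> hx; elim: n => [|n IH] //; rewrite exprS -[n.+1]add1n; apply: lowdegM.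
Qed.

Lemma lowdeg_le M M' f : (M <= M')%N -> lowdeg M' f -> lowdeg M f.
Proof. by move=> le h c hc; apply: h; apply: leq_trans le. Qed.

Lemma lowdeg_prod (I : Type) (r : seq I) (F : I -> S) (d : I -> nat) :
  (forall i, lowdeg (d i) (F i)) -> lowdeg (\sum_(i <- r) d i) (\prod_(i <- r) F i).
Proof.
move=> h; elim: r => [|i r IH]; first by rewrite !big_nil.
by rewrite !big_cons; apply: lowdegM.
Qed.

Lemma lowdeg_gen v : lowdeg 1 (gen q_gt0 B v).
Proof.
move=> c hc; rewrite monoE; case: eqP => // e; move: hc.
by rewrite e (bigD1 v) //= ffunE eqxx.
Qed.

Lemma lowdegMB M f f' g g' :
  lowdeg M (f - f') -> lowdeg M (g - g') -> lowdeg M (f * g - f' * g').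
Proof.
move=> hf hg; rewrite -[f * g](subrK (f' * g)) -mulrBl -addrA -mulrBr.
by apply: lowdegD; [apply: lowdegl|apply: lowdegr].
Qed.

Lemma lowdeg_trans M f g h : lowdeg M (f - g) -> lowdeg M (g - h) -> lowdeg M (f - h).
Proof. by move=> h1 h2; rewrite -(subrKA g); apply: lowdegD. Qed.

Lemma lowdeg_sym M f g : lowdeg M (f - g) -> lowdeg M (g - f).
Proof. by move=> h; rewrite -opprB; apply: lowdegN. Qed.

Lemma lowdeg_refl M f : lowdeg M (f - f).
Proof. by rewrite subrr. Qed.

Lemma lowdeg_eq f g : (forall M, lowdeg M (f - g)) -> f = g.
Proof.
move=> h; apply/qseriesP => c; apply/subr0_eq.
exact: (h (\sum_v c v).+1 c (leqnn _)).
Qed.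

Definition qexp_coeff n : R := (\prod_(1 <= k < n.+1) (1 - q ^+ k))^-1.
Definition qexp_trunc M x : S := \sum_(n < M) qexp_coeff n *: (- x) ^+ n.

Lemma sum_coefE (I : Type) (r : seq I) (P : pred I) (F : I -> S) c :
  (\sum_(i <- r | P i) F i) c = \sum_(i <- r | P i) F i c.
Proof. exact: (big_morph (fun f : S => f c) (fun f g => qaddE f g c)). Qed.

Lemma qexp_truncP M x : lowdeg 1 x -> lowdeg M (qexp x - qexp_trunc M x).
Proof.
move=> hx c hc; apply/eqP; change (qexp x c - qexp_trunc M x c == 0); rewrite subr_eq0; apply/eqP.
have x0 : x 0 = 0 by apply: hx; rewrite big1 // => v _; rewrite ffunE.
rewrite qexp_coef // sum_coefE (big_ord_widen M (fun n => qexp_coeff n * ((- x) ^+ n) c)) //.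
rewrite big_mkcond; apply: eq_bigr => n _; rewrite qscaleE; case: ltnP => // h.
by rewrite (lowdegX (lowdegN hx)) ?mulr0.
Qed.

(** The relation passes from [x] to its powers, hence holds exactly for the truncations, which
    approximate the exponentials to any order. *)
Lemma qexp_intertwine z x x' : lowdeg 1 x -> lowdeg 1 x' -> z * x = x' * z ->
  z * qexp x = qexp x' * z.
Proof.
move=> hx hx' e; apply: lowdeg_eq => M.
have eT : z * qexp_trunc M x = qexp_trunc M x' * z.
  rewrite mulr_sumr mulr_suml; apply: eq_bigr => n _.
  rewrite -scalerAr -scalerAl; congr (_ *: _).
  elim: (n : nat) => [|k IH]; first by rewrite !expr0 mulr1 mul1r.
  by rewrite exprS mulrA mulrN e -mulNr -mulrA IH mulrA -exprS.
apply: (@lowdeg_trans _ _ (qexp_trunc M x' * z)).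
  by rewrite -eT; apply: lowdegMB; [apply: lowdeg_refl|apply: qexp_truncP].
by apply: lowdegMB; [apply/lowdeg_sym/qexp_truncP|apply: lowdeg_refl].
Qed.

Lemma qexp0 : qexp (0 : S) = 1.
Proof.
apply: lowdeg_eq => M; apply: (@lowdeg_le _ M.+1) => //.
rewrite (_ : 1 = qexp_trunc M.+1 0); first exact/qexp_truncP.
rewrite /qexp_trunc big_ord_recl big1 ?addr0 => [|i _].
  by rewrite /qexp_coeff big_geq // invr1 scale1r expr0.
by rewrite oppr0 expr0n scaler0.
Qed.

Hypothesis q_lt1 : q < 1.

Lemma one_subXq n : 1 - q ^+ n.+1 != 0.
Proof. by rewrite subr_eq0 eq_sym lt_eqF // exprn_ilt1 ?ltW. Qed.

Lemma qexp_coeffS n : (1 - q ^+ n.+1) * qexp_coeff n.+1 = qexp_coeff n.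
Proof. by rewrite /qexp_coeff big_nat_recr //= invfM mulrCA mulfV ?mulr1 ?one_subXq. Qed.

(** The q-difference equation, a consequence of [qexp_coeffS]: the truncations of the two sides
    differ by a single term of degree at least [M.+1]. *)
Lemma qexpZ x : lowdeg 1 x -> qexp (q *: x) = (1 + x) * qexp x.
Proof.
move=> hx; apply: lowdeg_eq => M; apply: (@lowdeg_le _ M.+1) => //.
have hqx := lowdegZ q hx.
apply: (lowdeg_trans (@qexp_truncP M.+1 _ hqx)).
apply: (@lowdeg_trans _ _ ((1 + x) * qexp_trunc M.+1 x)); last first.
  by apply: lowdegMB; [apply: lowdeg_refl|apply/lowdeg_sym/qexp_truncP].
have -> : qexp_trunc M.+1 (q *: x) - (1 + x) * qexp_trunc M.+1 x
   = qexp_coeff M *: (- x) ^+ M.+1.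
  elim: M => [|M IH].
    rewrite /qexp_trunc !big_ord1 /qexp_coeff big_geq // invr1 !scale1r !expr0 expr1 mulr1.
    by rewrite opprD addrA subrr add0r.
  rewrite /qexp_trunc !(big_ord_recr M.+1) /= mulrDr opprD addrACA.
  rewrite -[X in X + _]/(qexp_trunc M.+1 (q *: x) - (1 + x) * qexp_trunc M.+1 x) IH.
  have -> : (1 + x) * (qexp_coeff M.+1 *: (- x) ^+ M.+1) =
      qexp_coeff M.+1 *: (- x) ^+ M.+1 - qexp_coeff M.+1 *: (- x) ^+ M.+2.
    by rewrite mulrDl mul1r [(- x) ^+ M.+2]exprS mulNr scalerN opprK scalerAr.
  rewrite -scalerN exprZn scalerA -qexp_coeffS opprB addrA addrCA.
  rewrite -[RHS]addr0; congr (_ + _); rewrite -scalerDl -scalerBl.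
  by rewrite (_ : _ - _ = 0) ?scale0r //; ring.
exact/lowdegZ/lowdegX/lowdegN.
Qed.

Lemma commXr x y n : y * x = q *: (x * y) -> y * x ^+ n = q ^+ n *: (x ^+ n * y).
Proof.
move=> h; elim: n => [|n IH]; first by rewrite !expr0 scale1r mulr1 mul1r.
by rewrite [in LHS]exprS mulrA h -scalerAl -(mulrA x) IH -scalerAr scalerA -exprS mulrA -exprS.
Qed.

(** The q-binomial theorem divided by the q-Pochhammer symbol, so that its coefficients are those of
    a product of two exponentials. *)
Lemma qbinomial x y n : y * x = q *: (x * y) ->
  qexp_coeff n *: (x + y) ^+ n =
  \sum_(k < n.+1) (qexp_coeff k * qexp_coeff (n - k)) *: (x ^+ k * y ^+ (n - k)).
Proof.
move=> yx; elim: n => [|n IH].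
  by rewrite big_ord1 !expr0 /qexp_coeff big_geq // !invr1 !mulr1.
apply: (scalerI (one_subXq n)); rewrite scalerA qexp_coeffS exprS scalerAr IH.
rewrite scaler_sumr mulr_sumr.
(* The q-Pascal rule [1 - q ^+ n.+1 = (1 - q ^+ k) + q ^+ k * (1 - q ^+ (n.+1 - k))]: the first part
   comes from a leading [x], the second from a leading [y] moved past [x ^+ k]. *)
have E (k : 'I_n.+2) : (1 - q ^+ n.+1) *: ((qexp_coeff k * qexp_coeff (n.+1 - k)) *: (x ^+ k * y ^+ (n.+1 - k)))
  = ((1 - q ^+ k) * qexp_coeff k * qexp_coeff (n.+1 - k)) *: (x ^+ k * y ^+ (n.+1 - k))
  + (q ^+ k * (1 - q ^+ (n.+1 - k)) * qexp_coeff k * qexp_coeff (n.+1 - k)) *: (x ^+ k * y ^+ (n.+1 - k)).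
  rewrite scalerA -scalerDl; congr (_ *: _).
  have -> : q ^+ n.+1 = q ^+ k * q ^+ (n.+1 - k) by rewrite -exprD subnKC // -ltnS ltn_ord.
  ring.
under [RHS]eq_bigr do rewrite E.
rewrite big_split /= [X in _ = X + _]big_ord_recl [X in _ = _ + X]big_ord_recr /=.
rewrite expr0 subrr !mul0r scale0r add0r subnn expr0 subrr mulr0 !mul0r scale0r addr0.
rewrite -big_split; apply: eq_bigr => k _ /=; rewrite /bump /= add1n subSS.
rewrite qexp_coeffS -scalerAr mulrDl scalerDr mulrA -exprS; congr (_ + _).
rewrite mulrA (commXr _ yx) -scalerAl -(mulrA (x ^+ k)) -exprS scalerA subSn; last by rewrite -ltnS ltn_ord.
by congr (_ *: _); rewrite -(qexp_coeffS (n - k)); ring.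
Qed.

(** Degree by degree this is [qbinomial]. The product of the truncations contains in addition only
    terms with [i + j >= M], which [lowdeg M] ignores. *)
Lemma qexpD x y : lowdeg 1 x -> lowdeg 1 y -> y * x = q *: (x * y) ->
  qexp (x + y) = qexp x * qexp y.
Proof.
move=> hx hy yx; apply: lowdeg_eq => M.
apply: (lowdeg_trans (@qexp_truncP M _ (lowdegD hx hy))).
apply: (@lowdeg_trans _ _ (qexp_trunc M x * qexp_trunc M y)); last first.
  by apply: lowdegMB; apply/lowdeg_sym/qexp_truncP.
have yxN : - y * - x = q *: (- x * - y) by rewrite !mulrNN.
pose F i j : S := (qexp_coeff i * qexp_coeff j) *: ((- x) ^+ i * (- y) ^+ j).
have -> : qexp_trunc M (x + y) = \sum_(i < M) \sum_(j < M - i) F i j.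
  rewrite triangle_sum /qexp_trunc opprD; apply: eq_bigr => n _.
  exact: qbinomial yxN.
rewrite /qexp_trunc big_distrlr -sumrB.
apply: lowdeg_sum => i _; apply/lowdeg_sym.
rewrite (big_ord_widen M (F i)) ?leq_subr //.
rewrite (bigID (fun j : 'I_M => (j < M - i)%N)) /=.
rewrite [X in X + _ - _](eq_bigr (fun j : 'I_M => F i j)) => [|j _]; last first.
  by rewrite -scalerAl -scalerAr scalerA.
rewrite addrAC subrr add0r; apply: lowdeg_sum => j hj; rewrite -scalerAl -scalerAr.
do 2!apply: lowdegZ; apply: (@lowdeg_le _ (i + j)); first lia.
by apply: lowdegM; apply/lowdegX/lowdegN.
Qed.
End Qexp.

(** * Continuity of the maps defined on generators *)

Section ContinuousMorphisms.
Variables (R : realType) (q : R) (q_gt0 : 0 < q).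
Variables (V : finType) (B : V -> V -> int).
Local Notation S := (qseries q_gt0 B).
Implicit Types (f x : S).

Lemma fsum_lowdeg (P : {ffun V -> nat} -> S) M f :
  (forall a : {ffun V -> nat}, lowdeg (\sum_v a v) (P a)) -> lowdeg M f ->
  lowdeg M (fsum (fun a => f a *: P a)).
Proof.
move=> hP hf c hc; rewrite fsumE; apply: fsbig1 => a _; rewrite qscaleE.
have [ha|ha] := ltnP (\sum_v a v) M; first by rewrite hf ?mul0r.
by rewrite hP ?mulr0 //; apply: leq_trans ha.
Qed.

Lemma alg_ext_lowdeg (z : V -> S) M f : (forall v, lowdeg 1 (z v)) ->
  lowdeg M f -> lowdeg M (alg_ext z f).
Proof.
move=> hz; apply: fsum_lowdeg => a; rewrite -big_enum /=.
by apply: lowdeg_prod => v; apply: lowdegX.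
Qed.

Lemma antialg_ext_lowdeg (z : V -> S) M f : (forall v, lowdeg 1 (z v)) ->
  lowdeg M f -> lowdeg M (antialg_ext z f).
Proof.
move=> hz; apply: fsum_lowdeg => a; rewrite -big_enum /= -(perm_big _ (_ : perm_eq (rev (enum V)) _)) ?perm_rev //.
by apply: lowdeg_prod => v; apply: lowdegX.
Qed.

(** Multiplicativity is assumed on powers of [x] only, so that homomorphisms and anti-homomorphisms
    are both covered. *)
Lemma morph_qexp (phi : S -> S) x : linear phi -> (forall n, phi (x ^+ n) = phi x ^+ n) ->
  (forall M f, lowdeg M f -> lowdeg M (phi f)) -> lowdeg 1 x ->
  phi (qexp x) = qexp (phi x).
Proof.
move=> lin hX hc hx; apply: lowdeg_eq => M.
have phi0 : phi 0 = 0 by have := lin (-1) 0 0; rewrite !scaleN1r oppr0 addr0 addNr.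
have phiZ k f : phi (k *: f) = k *: phi f by have := lin k f 0; rewrite phi0 !addr0.
have phiD f g : phi (f + g) = phi f + phi g by have := lin 1 f g; rewrite !scale1r.
have phiB f g : phi (f - g) = phi f - phi g by rewrite phiD -scaleN1r phiZ scaleN1r.
apply: (lowdeg_trans _ (lowdeg_sym (qexp_truncP (hc _ _ hx)))).
suff <- : phi (qexp_trunc M x) = qexp_trunc M (phi x).
  by rewrite -phiB; apply: hc; apply: qexp_truncP.
rewrite (big_morph phi phiD phi0); apply: eq_bigr => n _.
by rewrite phiZ -(scaleN1r x) -(scaleN1r (phi x)) !exprZn phiZ hX.
Qed.

Lemma antimorph_qexp (z : V -> S) x (phi := antialg_ext z) :
  linear phi -> phi 1 = 1 -> (forall f g, phi (f * g) = phi g * phi f) ->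
  (forall v, lowdeg 1 (z v)) -> lowdeg 1 x -> phi (qexp x) = qexp (phi x).
Proof.
move=> lin phi1 anti hz hx; apply: (morph_qexp lin _ _ hx) => [n|M f].
  by elim: n => [|n IH]; rewrite ?expr0 // exprS anti IH -exprSr.
exact: antialg_ext_lowdeg.
Qed.
End ContinuousMorphisms.

(** * The exchange relation and its growth by one summand at a time *)

Section ExchangeRing.
Variables (A : pzRingType) (y f g a b ef eg ea eb : A).
Hypothesis h : ef * eg * ((1 + f) * y) = y * (1 + g) * (ef * eg).

(** Here [ef], [eg], [eb] stand for exponentials. With [eb] in front, [h] applies, and what remains
    is [(1 + b) * eb * (1 + g) = (1 + g + b) * eb], which follows from [e3]. *)
Lemma exchange_addr_ring :
  ef * eb = eb * ef -> eb * y = y * ((1 + b) * eb) -> g * eb = (1 + b) * eb * g ->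
  ef * (eb * eg) * ((1 + f) * y) = y * (1 + (g + b)) * (ef * (eb * eg)).
Proof.
move=> e1 e2 e3; rewrite !(mulrA ef) e1 -2!(mulrA eb) h.
rewrite -(mulrA y) (mulrA eb) e2 -!(mulrA y); congr (y * _).
rewrite !mulrA; congr (_ * _ * _); rewrite mulrDr mulr1 -e3 -mulrDl.
by congr (_ * _); rewrite addrA addrAC.
Qed.

(** The new term [a * y] passes through [ef * eg] unchanged, and moving [ea] to the left of
    [y * (1 + g)] produces that same [a * y]. *)
Lemma exchange_addl_ring :
  y * ea = (1 + a) * ea * y -> y * g * ea = ea * (y * g) ->
  ef * (a * y) = a * y * ef -> eg * (a * y) = a * y * eg -> a * ea = ea * a ->
  ea * ef * eg * ((1 + (f + a)) * y) = y * (1 + g) * (ea * ef * eg).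
Proof.
move=> e1 e2 e3 e4 ca.
have e5 : ef * eg * (a * y) = a * y * (ef * eg).
  by rewrite -mulrA e4 mulrA e3 -mulrA.
have e6 : y * (1 + g) * ea = ea * (y * (1 + g) + a * y).
  rewrite mulrDr mulr1 mulrDl e1 e2 mulrDl mul1r ca mulrDl !mulrDr !mulrA.
  by rewrite addrAC.
rewrite addrA mulrDl -2!(mulrA ea) mulrDr e5 h -mulrDl (mulrA ea) -e6.
by rewrite !mulrA.
Qed.
End ExchangeRing.

Section Exchange.
Variables (R : realType) (q : R) (q_gt0 : 0 < q) (q_lt1 : q < 1).
Variables (V : finType) (B : V -> V -> int).
Local Notation S := (qseries q_gt0 B).
Implicit Types (x y a b f g : S).

Lemma qexp_comm z x : lowdeg 1 x -> GRing.comm z x -> GRing.comm z (qexp x).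
Proof. by move=> hx; exact: (qexp_intertwine hx hx). Qed.

Lemma qexp_scaled z x : lowdeg 1 x -> z * x = q *: (x * z) ->
  z * qexp x = (1 + x) * qexp x * z.
Proof.
move=> hx e; rewrite -(qexpZ q_lt1 hx).
by apply: (qexp_intertwine hx (lowdegZ q hx)); rewrite e scalerAl.
Qed.

Lemma qexp_scaledr z x : lowdeg 1 x -> x * z = q *: (z * x) ->
  qexp x * z = z * ((1 + x) * qexp x).
Proof.
move=> hx e; rewrite -(qexpZ q_lt1 hx).
by apply/esym/(qexp_intertwine (lowdegZ q hx) hx); rewrite e scalerAr.
Qed.

Definition exchange y f g :=
  qexp f * qexp g * ((1 + f) * y) = y * (1 + g) * (qexp f * qexp g).

Lemma exchange_addr y f g b : lowdeg 1 g -> lowdeg 1 f -> lowdeg 1 b ->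
  b * f = f * b -> g * b = q *: (b * g) -> b * y = q *: (y * b) ->
  exchange y f g -> exchange y f (g + b).
Proof.
move=> hg hf hb bf gb byq h; rewrite /exchange.
have -> : qexp (g + b) = qexp b * qexp g by rewrite addrC; exact: (qexpD q_lt1 hb hg gb).
apply: (exchange_addr_ring h).
- exact: (qexp_comm hb (commr_sym (qexp_comm hf bf))).
- exact: (qexp_scaledr hb byq).
- exact: (qexp_scaled hb gb).
Qed.

Lemma exchange_addl y f g a : lowdeg 1 g -> lowdeg 1 f -> lowdeg 1 a ->
  a * g = q *: (g * a) -> f * a = q *: (a * f) -> y * a = q *: (a * y) ->
  y * f = q *: (f * y) -> g * y = q *: (y * g) ->
  exchange y f g -> exchange y (f + a) g.
Proof.
move=> hg hf ha ag fa ya yf gy h; rewrite /exchange.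
have -> : qexp (f + a) = qexp a * qexp f by rewrite addrC; exact: (qexpD q_lt1 ha hf fa).
have q0 : q != 0 by rewrite gt_eqF.
apply: (exchange_addl_ring h).
- exact: (qexp_scaled ha ya).
(* In this and the next two cases two twists by [q] cancel: [a] commutes with [y * g], and both [f]
   and [g] commute with [a * y]. *)
- apply: (qexp_comm ha); apply: (scalerI q0).
  by rewrite -mulrA scalerAr -ag mulrA ya -scalerAl -mulrA.
- apply/esym/(qexp_comm hf); red.
  by rewrite -mulrA yf -scalerAr mulrA [RHS]mulrA fa -scalerAl.
- apply/esym/(qexp_comm hg); apply: (scalerI q0).
  by rewrite -mulrA scalerAr -gy mulrA ag -scalerAl mulrA.
- exact: (qexp_comm ha).
Qed.

(** The summands enter in the order [b 0], [a 0], [b 1], [a 1], and so on. Adding [a m] requires all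
    [b t] present to have [t <= m], so that they q-commute with it; adding [b k] requires all [a s]
    present to have [s < k], so that they commute with it. *)
Lemma exchange_sums y (a b : nat -> S) m :
  (forall s, lowdeg 1 (a s)) -> (forall s, lowdeg 1 (b s)) ->
  (forall s, y * a s = q *: (a s * y)) -> (forall s, b s * y = q *: (y * b s)) ->
  (forall s t, (s < t)%N -> a s * a t = q *: (a t * a s)) ->
  (forall s t, (s < t)%N -> b s * b t = q *: (b t * b s)) ->
  (forall s t, (t <= s)%N -> a s * b t = q *: (b t * a s)) ->
  (forall s t, (s < t)%N -> a s * b t = b t * a s) ->
  exchange y (\sum_(s < m) a s) (\sum_(s < m.+1) b s).
Proof.
move=> ha hb ya by_ aa bb ab ab0.
have lows n (c : nat -> S) : (forall s, lowdeg 1 (c s)) -> lowdeg 1 (\sum_(s < n) c s).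
  by move=> hc; apply: lowdeg_sum.
have addb n k : (n <= k)%N -> exchange y (\sum_(s < n) a s) (\sum_(s < k) b s) ->
    exchange y (\sum_(s < n) a s) (\sum_(s < k.+1) b s).
  move=> nk h; rewrite big_ord_recr /=; apply: exchange_addr => //; try exact: lows.
    rewrite mulr_sumr mulr_suml; apply: eq_bigr => s _.
    by rewrite ab0 //; apply: leq_trans nk.
  by rewrite mulr_sumr mulr_suml scaler_sumr; apply: eq_bigr => s _; apply: bb.
elim: m => [|m IH].
  apply: (addb 0%N 0%N (leqnn _)); rewrite !big_ord0 /exchange qexp0.
  by rewrite !addr0 !mul1r !mulr1.
apply: (addb _ _ (leqnn _)); rewrite [X in exchange _ X _]big_ord_recr /=.
apply: exchange_addl => //; try exact: lows.
- by rewrite mulr_sumr mulr_suml scaler_sumr; apply: eq_bigr => s _; apply: ab; rewrite -ltnS.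
- by rewrite mulr_sumr mulr_suml scaler_sumr; apply: eq_bigr => s _; apply: aa.
- by rewrite mulr_sumr mulr_suml scaler_sumr; apply: eq_bigr => s _; apply: ya.
- by rewrite mulr_sumr mulr_suml scaler_sumr; apply: eq_bigr => s _; apply: by_.
Qed.
End Exchange.

(** * Commutation up to a power of [q], and its exponent for two strings *)

Section QCommutation.
Variables (R : realType) (q : R) (q_gt0 : 0 < q) (A : algType R).
Implicit Types (x y z : A) (e : int).

Definition qcomm e x y := x * y = q ^ e *: (y * x).

Let q0 : q != 0. Proof. by rewrite gt_eqF. Qed.

Lemma qcommMr e e' x y z : qcomm e x y -> qcomm e' x z -> qcomm (e + e') x (y * z).
Proof.
move=> h1 h2; rewrite /qcomm mulrA h1 -scalerAl -(mulrA y x z) h2 -scalerAr scalerA mulrA.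
by rewrite -expfzDr.
Qed.

Lemma qcommMl e e' x y z : qcomm e x z -> qcomm e' y z -> qcomm (e + e') (x * y) z.
Proof.
move=> h1 h2; rewrite /qcomm -(mulrA x y z) h2 -scalerAr (mulrA x z y) h1 -scalerAl scalerA -(mulrA z x y).
by rewrite -expfzDr // addrC.
Qed.

Lemma qcomm_prodr x (F : nat -> A) (e : nat -> int) n : (forall k, qcomm (e k) x (F k)) ->
  qcomm (\sum_(0 <= k < n) e k) x (\prod_(0 <= k < n) F k).
Proof.
move=> h; elim: n => [|n IH].
  by rewrite !big_geq // /qcomm mulr1 mul1r expr0z scale1r.
by rewrite !big_nat_recr //=; apply: qcommMr.
Qed.

Lemma qcomm_prodl x (F : nat -> A) (e : nat -> int) n : (forall k, qcomm (e k) (F k) x) ->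
  qcomm (\sum_(0 <= k < n) e k) (\prod_(0 <= k < n) F k) x.
Proof.
move=> h; elim: n => [|n IH].
  by rewrite !big_geq // /qcomm mulr1 mul1r expr0z scale1r.
by rewrite !big_nat_recr //=; apply: qcommMl.
Qed.
End QCommutation.

(** Bare coordinates suffice: outside the quiver [Zgen] is 0 and satisfies every commutation
    relation, so [string_qcomm] holds without range conditions. *)
Definition edge_coord (i j i' j' : nat) : bool :=
  [|| (i' == i) && (j' == j.+1), (i' == i.+1) && (j' == j) |
      (i == i'.+1) && (j == j'.+1)]%N.

Definition incidence_coord (i j i' j' : nat) : int :=
  if edge_coord i j i' j' then 1 else if edge_coord i' j' i j then -1 else 0.

(* The number of integers in [y, y + l) that lie in [x, z). *)
Definition overlap (x z y l : nat) : nat := (minn (y + l) z - maxn y x)%N.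

Lemma overlapS x z y l : overlap x z y l.+1 = (overlap x z y l + (x <= y + l < z))%N.
Proof. by rewrite /overlap; case: (boolP (_ <= _ < _)%N) => /=; lia. Qed.

(* The exponent of q in the commutation of two strings, see [string_qcomm].  The two
   diagonals d = b - a and d' = b' - a' interact only if |d - d'| <= 1. *)
Definition string_weight (a b l a' b' l' : nat) : int :=
  if (b' + a == b + a')%N
  then (overlap a (a + l)%N a'.+1 l')%:Z - (overlap a.+1 (a.+1 + l)%N a' l')%:Z
  else if (b' + a == (b + a').+1)%N
  then (overlap a (a + l)%N a' l')%:Z - (overlap a (a + l)%N a'.+1 l')%:Z
  else if ((b' + a).+1 == b + a')%N
  then (overlap a.+1 (a.+1 + l)%N a' l')%:Z - (overlap a (a + l)%N a' l')%:Z
  else 0.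

(** An edge changes the diagonal [j - i] by at most one, and for each of the three possible
    differences either sign occurs once. Diagonals are compared additively because subtraction on
    [nat] truncates. *)
Lemma incidence_coord_diag (i j i' j' : nat) : incidence_coord i j i' j' =
  if (j' + i == j + i')%N then (i == i'.+1)%:Z - (i.+1 == i')%:Z
  else if (j' + i == (j + i').+1)%N then (i == i')%:Z - (i == i'.+1)%:Z
  else if ((j' + i).+1 == j + i')%N then (i.+1 == i')%:Z - (i == i')%:Z
  else 0.
Proof.
rewrite /incidence_coord /edge_coord.
do 3?[case: ifP => ?]; do ?[case: (i =P _) => ?]; do ?[case: (i.+1 =P _) => ?]; try lia;
  by do 2?[case: ifP => ?]; lia.
Qed.

Lemma sum_eq_nat (a y l : nat) :
  \sum_(0 <= k < l) (a + k == y)%N%:Z = (a <= y < a + l)%N%:Z :> int.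
Proof.
elim: l => [|l IH]; first by rewrite big_geq // addn0 leqNgt; case: ltnP.
rewrite big_nat_recr //= IH -PoszD; congr Posz.
by case: eqP => ?; do 2?[case: (boolP (_ && _)) => ? /=]; lia.
Qed.

(** The inner sum turns each Kronecker delta into the indicator of an interval, which by [overlapS]
    is the growth of an overlap when [l'] increases by one. The outer sum then telescopes. *)
Lemma string_weight_sum (a b l a' b' l' : nat) :
  \sum_(0 <= k' < l') \sum_(0 <= k < l) incidence_coord (a + k)%N (b + k)%N (a' + k')%N (b' + k')%N
  = string_weight a b l a' b' l'.
Proof.
have E (k' : nat) : \sum_(0 <= k < l) incidence_coord (a + k)%N (b + k)%N (a' + k')%N (b' + k')%N =
  string_weight a b l a' b' k'.+1 - string_weight a b l a' b' k'.
  transitivity (if (b' + a == b + a')%N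
    then (a <= a'.+1 + k' < a + l)%N%:Z - (a.+1 <= a' + k' < a.+1 + l)%N%:Z
    else if (b' + a == (b + a').+1)%N
    then (a <= a' + k' < a + l)%N%:Z - (a <= a'.+1 + k' < a + l)%N%:Z
    else if ((b' + a).+1 == b + a')%N
    then (a.+1 <= a' + k' < a.+1 + l)%N%:Z - (a <= a' + k' < a + l)%N%:Z
    else 0); last first.
    rewrite /string_weight !overlapS !PoszD.
    by do 3?[case: ifP => _]; rewrite ?subrr // ?opprD addrACA addrC ?addKr; ring.
  under eq_bigr do rewrite incidence_coord_diag.
  have e1 k : (b' + k' + (a + k) == b + k + (a' + k'))%N = (b' + a == b + a')%N by lia.
  have e2 k : (b' + k' + (a + k) == (b + k + (a' + k')).+1)%N = (b' + a == (b + a').+1)%N by lia.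
  have e3 k : ((b' + k' + (a + k)).+1 == b + k + (a' + k'))%N = ((b' + a).+1 == b + a')%N by lia.
  under eq_bigr do rewrite e1 e2 e3.
  do 3?[case: ifP => _]; try (by rewrite big1); under eq_bigr do rewrite -!addSn; rewrite sumrB !sum_eq_nat //.
elim: l' => [|l' IH]; last by rewrite big_nat_recr //= IH E addrC subrK.
by rewrite big_geq // /string_weight /overlap; do ?[case: eqP => ?]; lia.
Qed.

(** * Strings, and the commutation rules of those ending at nearby vertices *)

Section Strings.
Variables (R : realType) (q : R) (q_gt0 : 0 < q) (N : nat).
Local Notation That := (qseries q_gt0 (@incidence N)).
Local Notation Z := (Zgen q_gt0 N).

Lemma Zgen_case i j :
  (exists2 v : vertex N, vi v = i /\ vj v = j & Z i j = gen q_gt0 (@incidence N) v)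
  \/ Z i j = 0.
Proof.
rewrite /Zgen; case: pickP => [v /andP[/eqP hi /eqP hj]|_]; last by right.
by left; exists v.
Qed.

Lemma Zgen_out i j : ~~ ((0 < i < j)%N && (j <= N)%N) -> Z i j = 0.
Proof.
by case: (Zgen_case i j) => // -[v [<- <-] _] /negP[]; apply: vertex_range.
Qed.

Lemma Zgen_lowdeg i j : lowdeg 1 (Z i j).
Proof. by case: (Zgen_case i j) => [[v _ ->]|->] //; apply: lowdeg_gen. Qed.

Lemma Zgen_qcomm i j i' j' : qcomm q (incidence_coord i j i' j') (Z i j) (Z i' j').
Proof.
case: (Zgen_case i j) => [[v [<- <-] _]|->]; last by rewrite /qcomm mul0r mulr0 scaler0.
case: (Zgen_case i' j') => [[w [<- <-] _]|->]; last by rewrite /qcomm mul0r mulr0 scaler0.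
exact: Zgen_comm.
Qed.

Definition string a b l : That := \prod_(0 <= k < l) Z (a + k)%N (b + k)%N.

Lemma string1 a b : string a b 1 = Z a b.
Proof. by rewrite /string big_nat1 !addn0. Qed.

Lemma stringSr a b l : string a b l.+1 = string a b l * Z (a + l)%N (b + l)%N.
Proof. by rewrite /string big_nat_recr. Qed.

Lemma string_out a b l : ~~ (0 < a < b)%N -> string a b l.+1 = 0.
Proof.
move=> h; rewrite /string big_nat_recl // !addn0 Zgen_out ?mul0r //.
by apply: contra h => /andP[].
Qed.

Lemma string_lowdeg a b l : lowdeg 1 (string a b l.+1).
Proof. by rewrite stringSr; apply/lowdegr/Zgen_lowdeg. Qed.

Lemma string_qcomm a b l a' b' l' :
  qcomm q (string_weight a b l a' b' l') (string a b l) (string a' b' l').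
Proof.
rewrite -string_weight_sum; apply: (qcomm_prodr q_gt0) => k'.
by apply: (qcomm_prodl q_gt0) => k; apply: Zgen_qcomm.
Qed.

Lemma string_comm a b l a' b' l' : string_weight a b l a' b' l' = 0 ->
  string a b l * string a' b' l' = string a' b' l' * string a b l.
Proof. by move=> h; have := string_qcomm a b l a' b' l'; rewrite /qcomm h expr0z scale1r. Qed.

Lemma string_comm1 a b l a' b' l' : string_weight a b l a' b' l' = 1 ->
  string a b l * string a' b' l' = q *: (string a' b' l' * string a b l).
Proof. by move=> h; have := string_qcomm a b l a' b' l'; rewrite /qcomm h expr1z. Qed.

(* The string of length s + 1 that ends at the vertex (i, n).  For s >= i the truncated
   subtraction puts its first factor outside the quiver, so that it is 0. *)
Definition tail i n s : That := string (i - s) (n - s) s.+1.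

Lemma tail_out i n s : (i <= s)%N -> tail i n s = 0.
Proof. by move=> h; apply: string_out; lia. Qed.

Lemma tail_lowdeg i n s : lowdeg 1 (tail i n s).
Proof. exact: string_lowdeg. Qed.

Local Ltac weight := rewrite /string_weight /overlap; do ?[case: eqP => ?]; lia.

(** Here and in the next six lemmas a tail too long to fit in the quiver is 0, which makes both
    sides vanish. Otherwise the subtractions in [tail] do not truncate and [string_weight] is
    evaluated by cases. *)
Lemma tail_same i n s t : (i <= n)%N -> (s < t)%N ->
  tail i n s * tail i n t = q *: (tail i n t * tail i n s).
Proof.
move=> hi st; have [h|h] := leqP i t; first by rewrite (tail_out n h) mulr0 mul0r scaler0.
apply: string_comm1; weight.
Qed.

Lemma tail_next1 i n s t : (i < n)%N -> (t <= s)%N ->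
  tail i n s * tail i.+1 n t = q *: (tail i.+1 n t * tail i n s).
Proof.
move=> hi st; have [h|h] := leqP i s; first by rewrite (tail_out n h) mulr0 mul0r scaler0.
apply: string_comm1; weight.
Qed.

Lemma tail_next0 i n s t : (i < n)%N -> (s < t)%N ->
  tail i n s * tail i.+1 n t = tail i.+1 n t * tail i n s.
Proof.
move=> hi st; have [h|h] := leqP i.+1 t; first by rewrite (tail_out n h) mulr0 mul0r.
apply: string_comm; weight.
Qed.

Lemma tail_far i k n s t : (i.+1 < k <= n)%N ->
  tail i n s * tail k n t = tail k n t * tail i n s.
Proof.
move=> hi; have [h|h] := leqP i s; first by rewrite (tail_out n h) mulr0 mul0r.
have [h'|h'] := leqP k t; first by rewrite (tail_out n h') mulr0 mul0r.
apply: string_comm; weight.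
Qed.

Lemma Zgen_tail i n s : (i < n)%N ->
  Z i.+1 n.+1 * tail i n s = q *: (tail i n s * Z i.+1 n.+1).
Proof.
move=> hi; have [h|h] := leqP i s; first by rewrite (tail_out n h) mulr0 mul0r scaler0.
rewrite -string1; apply: string_comm1; weight.
Qed.

Lemma tail_Zgen i n s : (i <= n)%N ->
  tail i n s * Z i n.+1 = q *: (Z i n.+1 * tail i n s).
Proof.
move=> hi; have [h|h] := leqP i s; first by rewrite (tail_out n h) mulr0 mul0r scaler0.
rewrite -string1; apply: string_comm1; weight.
Qed.

Lemma Zgen_tail_comm i n k m s : (i <= n)%N -> (k <= m)%N -> (m < n)%N || ((m == n) && (k != i) && (k.+1 != i)) ->
  Z i n.+1 * tail k m s = tail k m s * Z i n.+1.
Proof.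
move=> hi hk hm; have [h|h] := leqP k s; first by rewrite (tail_out m h) mulr0 mul0r.
rewrite -string1; apply: string_comm; weight.
Qed.

End Strings.

Lemma vertex_range_ind N (P : nat -> nat -> Prop) :
  (forall v : vertex N, P (vi v) (vj v)) ->
  forall i j, (0 < i < j)%N && (j <= N)%N -> P i j.
Proof.
move=> h i j hij.
have hi : (i < N.+1)%N by lia.
have hj : (j < N.+1)%N by lia.
have hv : (0 < (Ordinal hi, Ordinal hj).1 < (Ordinal hi, Ordinal hj).2)%N by rewrite /=; lia.
by have := h (exist _ (Ordinal hi, Ordinal hj) hv : vertex N).
Qed.

(** * Columns, rows and the intertwining relation *)

Section Columns.
Variables (R : realType) (q : R) (q_gt0 : 0 < q) (q_lt1 : q < 1) (N : nat).
Local Notation That := (qseries q_gt0 (@incidence N)).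
Local Notation Z := (Zgen q_gt0 N).
Local Notation tail := (tail q_gt0 N).

Definition column i n : That := \sum_(s < i) tail i n s.

Lemma column_lowdeg i n : lowdeg 1 (column i n).
Proof. by apply: lowdeg_sum => s _; apply: tail_lowdeg. Qed.

Lemma column0 n : column 0 n = 0.
Proof. by rewrite /column big_ord0. Qed.

Lemma columnn n : column n n = 0.
Proof. by rewrite /column big1 // => s _; apply: string_out; rewrite ltnn andbF. Qed.

(** A string ending at [(i.+1, n.+1)] is the generator there, either alone or preceded by a string
    ending at [(i, n)]. *)
Lemma columnS i n : (i <= n)%N -> column i.+1 n.+1 = (1 + column i n) * Z i.+1 n.+1.
Proof.
move=> hi; rewrite /column big_ord_recl mulrDl mul1r mulr_suml; congr (_ + _).
  by rewrite /tail !subn0 string1.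
apply: eq_bigr => s _; rewrite /tail /= /bump add1n !subSS stringSr.
have hs : (s < i)%N by [].
by rewrite !addnS !subnK // ltnW // (leq_trans hs).
Qed.

Lemma column_comm i k n : (i.+1 < k <= n)%N -> GRing.comm (column i n) (column k n).
Proof.
move=> h; apply: commr_sum => t _; apply: commr_sym; apply: commr_sum => s _.
by apply: commr_sym; apply: tail_far.
Qed.

Lemma Zgen_column_comm i n k m : (i <= n)%N -> (k <= m)%N ->
  (m < n)%N || ((m == n) && (k != i) && (k.+1 != i)) ->
  GRing.comm (Z i n.+1) (column k m).
Proof. by move=> hi hk hm; apply: commr_sum => s _; apply: Zgen_tail_comm. Qed.

Lemma column_exchange i n : (i < n)%N ->
  exchange (Z i.+1 n.+1) (column i n) (column i.+1 n).
Proof.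
move=> hi; apply: (exchange_sums q_lt1).
- by move=> s; apply: tail_lowdeg.
- by move=> s; apply: tail_lowdeg.
- by move=> s; apply: Zgen_tail.
- by move=> s; apply: tail_Zgen.
- by move=> s t; apply: tail_same; apply: ltnW.
- by move=> s t; apply: tail_same.
- by move=> s t; apply: tail_next1.
- by move=> s t; apply: tail_next0.
Qed.

(** This is C_n. Its factors at [i = 0] and [i = n] equal 1; keeping them lets
    [column_prod_exchange] treat boundary vertices like the others. *)
Definition column_prod n : That := \prod_(0 <= i < n.+1) qexp (column i n).
Definition column_prods n : That := \prod_(0 <= m < n.+1) column_prod m.

Lemma column_prodsS n : column_prods n.+1 = column_prods n * column_prod n.+1.
Proof. by rewrite /column_prods big_nat_recr. Qed.

(** Only the factors of the columns [i] and [i.+1] interact, through [column_exchange]. Those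
    further right commute with [(1 + column i n) * Z i.+1 n.+1], those further left with
    [Z i.+1 n.+1 * (1 + column i.+1 n)]. *)
Lemma column_prod_exchange i n : (i < n)%N ->
  column_prod n * column i.+1 n.+1 = Z i.+1 n.+1 * (1 + column i.+1 n) * column_prod n.
Proof.
move=> hi; rewrite columnS; last exact: ltnW.
have -> : column_prod n = \prod_(0 <= k < i) qexp (column k n) *
    (qexp (column i n) * qexp (column i.+1 n)) * \prod_(i.+2 <= k < n.+1) qexp (column k n).
  rewrite /column_prod (@big_cat_nat _ _ _ i) //=; last by lia.
  rewrite [X in _ * X]big_ltn; last by lia.
  rewrite [X in _ * (_ * X)]big_ltn; last by lia.
  by rewrite !mulrA.
set P1 := \prod_(0 <= k < i) _; set P2 := \prod_(i.+2 <= k < _) _.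
have c2 : GRing.comm P2 ((1 + column i n) * Z i.+1 n.+1).
  apply: commr_sym; rewrite /P2 big_nat_cond; apply: commr_prod => k /andP[hk _].
  apply: qexp_comm; first exact: column_lowdeg.
  apply: commr_sym; apply: commrM; last first.
    by apply: commr_sym; apply: Zgen_column_comm; lia.
  apply: commrD; first exact: commr1.
  by apply: commr_sym; apply: column_comm; lia.
have c1 : GRing.comm P1 (Z i.+1 n.+1 * (1 + column i.+1 n)).
  apply: commr_sym; rewrite /P1 big_nat_cond; apply: commr_prod => k /andP[hk _].
  apply: qexp_comm; first exact: column_lowdeg.
  apply: commr_sym; apply: commrM.
    by apply: commr_sym; apply: Zgen_column_comm; lia.
  apply: commrD; first exact: commr1.
  by apply: column_comm; lia.
rewrite -mulrA c2 mulrA -(mulrA P1) (column_exchange hi) (mulrA P1) c1.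
by rewrite -!mulrA.
Qed.

Lemma Zgen_column_prods i n : (i <= n.+1)%N -> GRing.comm (Z i n.+2) (column_prods n).
Proof.
move=> hi; rewrite /column_prods big_nat_cond; apply: commr_prod => m /andP[hm _].
rewrite /column_prod big_nat_cond; apply: commr_prod => k /andP[hk _].
apply: qexp_comm; first exact: column_lowdeg.
by apply: Zgen_column_comm; lia.
Qed.

Lemma mu1_qexp (x : That) : lowdeg 1 x -> mu1 (qexp x) = qexp (mu1 x).
Proof.
have [lin one anti _] := mu1_antimorphism q_gt0 N.
by apply: (antimorph_qexp lin one anti) => v; apply: Zgen_lowdeg.
Qed.

(* The sum of the Z_{k,n} Z_{k,n-1} ... Z_{k,m} over k < m <= n; see [rowS]. *)
Definition row k n : That := mu1 (column (n - k) n).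

Lemma mu1_0 : mu1 (0 : That) = 0.
Proof.
by have [lin _ _ _] := mu1_antimorphism q_gt0 N; have := lin (-1) 0 0; rewrite !scaleN1r oppr0 addr0 addNr.
Qed.

Lemma rown n : row n n = 0.
Proof. by rewrite /row subnn column0 mu1_0. Qed.

Lemma row0 n : row 0 n = 0.
Proof. by rewrite /row subn0 columnn mu1_0. Qed.

Lemma rowS k n : (0 < k <= n)%N -> (n < N)%N -> row k n.+1 = Z k n.+1 * (1 + row k n).
Proof.
move=> hk hn; have [lin one anti gens] := mu1_antimorphism q_gt0 N.
rewrite /row subSn; last by lia.
rewrite columnS ?leq_subr // anti.
rewrite (vertex_range_ind (P := fun i j => mu1 (Z i j) = Z (j - i) j) gens); last by lia.
have -> : (n.+1 - (n - k).+1 = k)%N by lia.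
congr (_ * _); have := lin 1 1 (column (n - k) n).
by rewrite !scale1r one.
Qed.

Lemma column_prods_column i n : (i <= n.+1)%N -> (n < N)%N ->
  column_prods n * column i n.+1 = row i n.+1 * column_prods n.
Proof.
elim: n i => [|n IH] [|i] hi hn; rewrite ?column0 ?row0 ?mulr0 ?mul0r //.
  have -> : i = 0%N by lia.
  by rewrite columnn rown mulr0 mul0r.
have [e|ne] := eqVneq i n.+1; first by rewrite e columnn rown mulr0 mul0r.
rewrite column_prodsS -mulrA column_prod_exchange; last by lia.
(* The generator lies at least two columns beyond those in [column_prods n], hence commutes with it;
   the induction hypothesis then turns the remaining column into a row, and [rowS] reassembles. *)
rewrite mulrA (mulrA (column_prods n)) -(Zgen_column_prods (i := i.+1)); last by lia.
rewrite -(mulrA (Z _ _)) mulrDr mulr1 IH; [|lia..].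
rewrite (@rowS i.+1 n.+1); [|lia..].
by rewrite -{1}[column_prods n]mul1r -mulrDl !mulrA.
Qed.

Lemma row_lowdeg k n : lowdeg 1 (row k n).
Proof. by apply: antialg_ext_lowdeg (column_lowdeg _ _) => v; apply: Zgen_lowdeg. Qed.

(** The reversal caused by [mu1] and the index [n - k] in [row] cancel, so the factors are again in
    increasing order. *)
Lemma mu1_column_prod n : mu1 (column_prod n) = \prod_(0 <= i < n.+1) qexp (row i n).
Proof.
have [lin one anti _] := mu1_antimorphism q_gt0 N.
rewrite /column_prod (antimorph_prod_nat _ _ one anti).
by apply: eq_bigr => i _; rewrite (mu1_qexp (column_lowdeg _ _)) subSS.
Qed.

Lemma mu1_column_prods n : (n <= N)%N -> mu1 (column_prods n) = column_prods n.
Proof.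
have [lin one anti _] := mu1_antimorphism q_gt0 N.
elim: n => [|n IH] hn.
  rewrite /column_prods /column_prod !big_nat1 column0 qexp0.
  exact: one.
rewrite column_prodsS anti IH ?mu1_column_prod; last exact: ltnW.
rewrite /column_prod !big_nat.
have h i : (i <= n.+1)%N ->
    column_prods n * qexp (column i n.+1) = qexp (row i n.+1) * column_prods n.
  move=> hi; apply: (qexp_intertwine (column_lowdeg _ _) (row_lowdeg _ _)).
  exact: column_prods_column.
suff H m : (m <= n.+2)%N -> column_prods n * \prod_(0 <= i < m) qexp (column i n.+1) =
    \prod_(0 <= i < m) qexp (row i n.+1) * column_prods n by rewrite -!big_nat H.
elim: m => [|m IHm] hm; first by rewrite !big_geq // mulr1 mul1r.
rewrite !big_nat_recr //= mulrA IHm; last exact: ltnW.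
by rewrite -mulrA h // mulrA.
Qed.

(** By [tail_same], [qexpD] splits off the longest tail on the left. Longer tails start at smaller
    [a = i - s], so the factors appear with [a] increasing. *)
Lemma qexp_tails i n m : (i <= n)%N -> (m <= i)%N -> qexp (\sum_(s < m) tail i n s) =
  \prod_(i.+1 - m <= a < i.+1) Rfactor q_gt0 N a (a + n - i) n.+1.
Proof.
move=> hi; elim: m => [|m IH] hm; first by rewrite big_ord0 qexp0 big_geq // subn0.
rewrite big_ord_recr /= addrC.
have -> : qexp (tail i n m + \sum_(s < m) tail i n s) = qexp (tail i n m) * qexp (\sum_(s < m) tail i n s).
  have hs : lowdeg 1 (\sum_(s < m) tail i n s).
    by apply: lowdeg_sum => s _; apply: tail_lowdeg.
  apply: (qexpD q_lt1 (@tail_lowdeg _ q q_gt0 N i n m) hs).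
  rewrite mulr_sumr mulr_suml scaler_sumr; apply: eq_bigr => s _.
  by apply: tail_same.
rewrite (IH (ltnW hm)) subSS [RHS]big_ltn; last by rewrite ltnS leq_subr.
rewrite subSn; last exact: ltnW.
suff -> : Rfactor q_gt0 N (i - m) (i - m + n - i) n.+1 = qexp (tail i n m) by [].
have e : (i - m + n - i = n - m)%N by lia.
rewrite /Rfactor e subSn ?leq_subr // subKn //.
by apply: leq_trans hi; apply: ltnW.
Qed.

Lemma column_prodE n : column_prod n =
  \prod_(1 <= i < n) \prod_(1 <= a < i.+1) Rfactor q_gt0 N a (a + n - i) n.+1.
Proof.
rewrite /column_prod; case: n => [|n].
  by rewrite big_nat1 column0 qexp0 big_geq.
rewrite big_nat_recr //= columnn qexp0 mulr1 big_ltn // column0 qexp0 mul1r.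
apply: eq_big_nat => i hi; rewrite /column qexp_tails //; last by lia.
by rewrite subSn // subnn.
Qed.

End Columns.

(** * The lexicographic and the column order on triples *)

Section Triples.
Variable N : nat.
Implicit Types x y : nat * nat * nat.

Definition valid_triple x := (0 < x.1.1 < x.1.2)%N && (x.1.2 < x.2 <= N.+1)%N.

Definition lex_lt x y := [|| (x.1.1 < y.1.1)%N,
  (x.1.1 == y.1.1) && (x.1.2 < y.1.2)%N | (x.1 == y.1) && (x.2 < y.2)%N].

(** The order of the factors in C_1 ... C_N: by [c = n.+1], then by the end vertex [(i, n)], then by
    the start [a]. As [i = n - (b - a)], increasing [i] means decreasing [b - a], which is compared
    additively. *)
Definition column_lt x y := [|| (x.2 < y.2)%N,
  (x.2 == y.2) && (y.1.2 + x.1.1 < x.1.2 + y.1.1)%N |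
  [&& x.2 == y.2, y.1.2 + x.1.1 == x.1.2 + y.1.1 & x.1.1 < y.1.1]%N].

Definition lex_triples : seq (nat * nat * nat) :=
  [seq (p, c) | p <- [seq (a, b) | a <- index_iota 1 N.+2, b <- index_iota a.+1 N.+2],
                c <- index_iota p.2.+1 N.+2].

Definition column_triples : seq (nat * nat * nat) :=
  [seq (a, a + p.1 - p.2, p.1.+1)%N |
     p <- [seq (n, i) | n <- index_iota 0 N.+1, i <- index_iota 1 n],
     a <- index_iota 1 p.2.+1].

Lemma mem_lex_triples x : (x \in lex_triples) = valid_triple x.
Proof.
apply/idP/idP.
  case/allpairsPdep => -[a b] [c [/allpairsPdep[a' [b' [ha hb [-> ->]]]] hc ->]].
  by move: ha hb hc; rewrite /valid_triple !mem_index_iota /=; lia.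
case: x => [[a b] c]; rewrite /valid_triple /= => h.
apply/allpairsPdep; exists (a, b), c; split=> //; last by rewrite mem_index_iota /=; lia.
by apply/allpairsPdep; exists a, b; split=> //; rewrite mem_index_iota; lia.
Qed.

Lemma mem_column_triples x : (x \in column_triples) = valid_triple x.
Proof.
apply/idP/idP.
  case/allpairsPdep => -[n i] [a [/allpairsPdep[n' [i' [hn hi [-> ->]]]] ha ->]].
  by move: hn hi ha; rewrite /valid_triple !mem_index_iota /=; lia.
case: x => [[a b] c]; rewrite /valid_triple /= => h; apply/allpairsPdep.
exists (c.-1, (c.-1 + a - b)%N), a; split.
- by apply/allpairsPdep; exists c.-1, (c.-1 + a - b)%N; split=> //; rewrite mem_index_iota; lia.
- by rewrite mem_index_iota /=; lia.
- by rewrite /=; congr (_, _, _); lia.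
Qed.

Lemma pairwise_lex_triples : pairwise lex_lt lex_triples.
Proof.
apply: (pairwise_allpairs (rJ := ltn) (rI := fun p p' =>
    (p.1 < p'.1)%N || (p.1 == p'.1) && (p.2 < p'.2)%N)).
- apply: (pairwise_allpairs (rJ := ltn) (rI := ltn)) => *; rewrite ?pairwise_index_iota //=.
    by apply/orP; left.
  by apply/orP; right; rewrite eqxx.
- by move=> *; apply: pairwise_index_iota.
- move=> [a b] [a' b'] c c' _ _ _ _ /=; rewrite /lex_lt /=.
  by case/orP => [->|/andP[-> ->]]; rewrite ?orbT.
- by move=> p c c' _ _ _ /= h; rewrite /lex_lt /= !eqxx h !orbT.
Qed.

Lemma pairwise_column_triples : pairwise column_lt column_triples.
Proof.
apply: (pairwise_allpairs (rJ := ltn) (rI := fun p p' =>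
    (p.1 < p'.1)%N || (p.1 == p'.1) && (p.2 < p'.2)%N)).
- apply: (pairwise_allpairs (rJ := ltn) (rI := ltn)) => *; rewrite ?pairwise_index_iota //=.
    by apply/orP; left.
  by apply/orP; right; rewrite eqxx.
- by move=> *; apply: pairwise_index_iota.
- move=> p p' a a' /allpairsPdep[n [i [hn hi ->]]] /allpairsPdep[n' [i' [hn' hi' ->]]].
  by move: hn hi hn' hi'; rewrite /column_lt !mem_index_iota /=; lia.
- move=> p a a' /allpairsPdep[n [i [hn hi ->]]].
  by move: hn hi; rewrite /column_lt !mem_index_iota /=; lia.
Qed.

Lemma lex_triples_uniq : uniq lex_triples.
Proof.
have irr : irreflexive lex_lt by move=> x; rewrite /lex_lt !ltnn !andbF.
exact: (pairwise_uniq irr pairwise_lex_triples).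
Qed.

Lemma column_lt_irr : irreflexive column_lt.
Proof. by move=> x; rewrite /column_lt !ltnn !andbF. Qed.

End Triples.

(** * [TN] as the product of the columns *)

Section Reordering.
Variables (R : realType) (q : R) (q_gt0 : 0 < q) (q_lt1 : q < 1) (N : nat).
Local Notation That := (qseries q_gt0 (@incidence N)).
Local Notation valid_triple := (valid_triple N).
Implicit Types x y : nat * nat * nat.

Definition triple_qexp x : That := Rfactor q_gt0 N x.1.1 x.1.2 x.2.

Lemma TN_lex : TN q_gt0 N = \prod_(x <- lex_triples N) triple_qexp x.
Proof. by rewrite /lex_triples !big_allpairs_dep. Qed.

Lemma column_prods_triples :
  column_prods q_gt0 N N = \prod_(x <- column_triples N) triple_qexp x.
Proof.
rewrite /column_triples !big_allpairs_dep; apply: eq_bigr => n _.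
exact: column_prodE.
Qed.

(** When the two orders disagree on a pair, either the diagonals do not interact or the two overlaps
    in [string_weight] are equal, so the strings commute. *)
Lemma triple_qexp_comm x y : valid_triple x -> valid_triple y ->
  lex_lt x y -> column_lt y x ->
  triple_qexp x * triple_qexp y = triple_qexp y * triple_qexp x.
Proof.
case: x y => [[a b] c] [[a' b'] c']; rewrite /valid_triple /lex_lt /column_lt /= => hx hy h1 h2.
have low u v w : (v < w)%N -> lowdeg 1 (string q_gt0 N u v (w - v)).
  by move=> h; rewrite -(@prednK (w - v)) ?subn_gt0 //; apply: string_lowdeg.
have lx : lowdeg 1 (string q_gt0 N a b (c - b)) by apply: low; lia.
have ly : lowdeg 1 (string q_gt0 N a' b' (c' - b')) by apply: low; lia.
apply: (qexp_comm ly); apply/commr_sym/(qexp_comm lx)/commr_sym.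
apply: string_comm; rewrite xpair_eqE in h1.
rewrite /string_weight /overlap; do ?[case: eqP => ?]; lia.
Qed.

(** An arbitrary sorted enumeration is allowed so that this serves both [column_triples] and the
    [mu2] image of the lexicographic list. *)
Lemma triples_prod (s : seq (nat * nat * nat)) : pairwise column_lt s ->
  (forall x, (x \in s) = valid_triple x) ->
  \prod_(x <- s) triple_qexp x = TN q_gt0 N.
Proof.
move=> ps ms; rewrite TN_lex; apply/esym.
apply: (prod_reorder (pairwise_lex_triples N) ps (lex_triples_uniq N)).
  apply: uniq_perm => [||x]; rewrite ?lex_triples_uniq ?mem_lex_triples ?ms //.
  exact: (pairwise_uniq column_lt_irr ps).
by move=> x y; rewrite !mem_lex_triples; apply: triple_qexp_comm.
Qed.

Lemma TN_column_prods : TN q_gt0 N = column_prods q_gt0 N N.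
Proof.
rewrite column_prods_triples (triples_prod (pairwise_column_triples N)) //.
exact: mem_column_triples.
Qed.
End Reordering.

(** * The symmetries of [TN] *)

Section Symmetry.
Variables (R : realType) (q : R) (q_gt0 : 0 < q) (q_lt1 : q < 1) (N : nat).
Local Notation That := (qseries q_gt0 (@incidence N)).
Local Notation Z := (Zgen q_gt0 N).
Local Notation T := (TN q_gt0 N).

Lemma mu2_qexp (x : That) : lowdeg 1 x -> mu2 (qexp x) = qexp (mu2 x).
Proof.
have [lin one anti _] := mu2_antimorphism q_gt0 N.
by apply: (antimorph_qexp lin one anti) => v; apply: Zgen_lowdeg.
Qed.

Lemma mu3_qexp (x : That) : lowdeg 1 x -> mu3 (qexp x) = qexp (mu3 x).
Proof.
have [lin one anti _] := mu3_antimorphism q_gt0 N.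
by apply: (antimorph_qexp lin one anti) => v; apply: Zgen_lowdeg.
Qed.

Lemma rho_qexp (x : That) : lowdeg 1 x -> rho (qexp x) = qexp (rho x).
Proof.
have [lin one mor _] := rho_morphism q_gt0 N.
move=> hx; apply: morph_qexp => //.
- elim=> [|n IH]; first by rewrite !expr0.
  by rewrite exprS mor IH -exprS.
- by move=> M f; apply: alg_ext_lowdeg => v; apply: Zgen_lowdeg.
Qed.

(** Since [mu2] reverses a string, the image starts with the image of the last factor, which sits at
    [(a + c - b - 1, c - 1)]; the length [c - b] is kept. *)
Definition mu2_triple (x : nat * nat * nat) : nat * nat * nat :=
  (N.+2 - x.2, N.+2 - x.2 + x.1.2 - x.1.1, N.+2 - x.1.1)%N.

Lemma mu2_tripleK : {in valid_triple N, involutive mu2_triple}.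
Proof.
move=> [[a b] c]; rewrite unfold_in /valid_triple /mu2_triple /= => h.
by congr (_, _, _); lia.
Qed.

Lemma mu2_triple_valid x : valid_triple N x -> valid_triple N (mu2_triple x).
Proof. by case: x => [[a b] c]; rewrite /valid_triple /mu2_triple /=; lia. Qed.

Lemma Rfactor_arg_lowdeg x : valid_triple N x ->
  lowdeg 1 (string q_gt0 N x.1.1 x.1.2 (x.2 - x.1.2)).
Proof.
move=> h; rewrite -(@prednK (x.2 - x.1.2)); first exact: string_lowdeg.
by move: h; rewrite /valid_triple; lia.
Qed.

Lemma mu2_triple_qexp x : valid_triple N x ->
  mu2 (triple_qexp q_gt0 N x) = triple_qexp q_gt0 N (mu2_triple x).
Proof.
have [lin one anti gens] := mu2_antimorphism q_gt0 N.
move=> hx; rewrite [LHS](mu2_qexp (Rfactor_arg_lowdeg hx)); congr (qexp _).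
rewrite (antimorph_prod_nat _ _ one anti).
case: x hx => [[a b] c]; rewrite /valid_triple /mu2_triple /= => hx.
have -> : (N.+2 - a - (N.+2 - c + b - a) = c - b)%N by lia.
apply: eq_big_nat => i hi.
rewrite (vertex_range_ind (P := fun i j => mu2 (Z i j) = Z (N.+1 - j) (N.+1 - i)) gens); last by lia.
by congr (Zgen _ _ _ _); lia.
Qed.

Lemma mu2_TN : mu2 T = T.
Proof.
have [lin one anti _] := mu2_antimorphism q_gt0 N.
rewrite {1}TN_lex (antimorph_prod_rev _ _ one anti).
rewrite (eq_big_seq (fun x => triple_qexp q_gt0 N (mu2_triple x))); last first.
  by move=> x; rewrite mem_rev mem_lex_triples => hx; apply: mu2_triple_qexp.
rewrite -(big_map mu2_triple predT (triple_qexp q_gt0 N)).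
apply: (triples_prod _ q_lt1).
(* [mu2_triple] keeps [b - a] and sends [a] to the last coordinate [N.+2 - a] and [c] to the first
   one [N.+2 - c], so [column_lt] on images is the reversed lexicographic comparison. *)
- rewrite pairwise_map pairwise_rev.
  apply: (sub_in_pairwise _ (allss _) (pairwise_lex_triples N)) => x y.
  rewrite !mem_lex_triples; case: x y => [[a b] c] [[a' b'] c'].
  rewrite /valid_triple /lex_lt /column_lt /mu2_triple /= xpair_eqE; lia.
- move=> x; apply/mapP/idP => [[y]|hx].
    by rewrite mem_rev mem_lex_triples => /mu2_triple_valid hy ->.
  exists (mu2_triple x); last by rewrite mu2_tripleK.
  by rewrite mem_rev mem_lex_triples mu2_triple_valid.
Qed.

Lemma mu1_TN : mu1 T = T.
Proof. by rewrite (TN_column_prods q_gt0 q_lt1) mu1_column_prods. Qed.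

(** [TN] is built from generators by products and exponentials alone, so agreement on generators
    suffices. *)
Lemma morph_TN_ext (f g : That -> That) :
  f 1 = 1 -> g 1 = 1 -> {morph f : x y / x * y} -> {morph g : x y / x * y} ->
  (forall x, lowdeg 1 x -> f (qexp x) = qexp (f x)) ->
  (forall x, lowdeg 1 x -> g (qexp x) = qexp (g x)) ->
  (forall v : vertex N, f (Z (vi v) (vj v)) = g (Z (vi v) (vj v))) ->
  f T = g T.
Proof.
move=> f1 g1 fM gM fq gq fg; rewrite TN_lex (big_morph f fM f1) (big_morph g gM g1).
apply: eq_big_seq => x; rewrite mem_lex_triples => hx.
have hl := Rfactor_arg_lowdeg hx.
rewrite [LHS](fq _ hl) [RHS](gq _ hl); congr (qexp _).
rewrite (big_morph f fM f1) (big_morph g gM g1).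
apply: eq_big_nat => k hk; apply: (vertex_range_ind (P := fun i j => f (Z i j) = g (Z i j)) fg).
by move: hx; rewrite /valid_triple; lia.
Qed.

Lemma rho_TN : rho T = T.
Proof.
have [_ rho1 rhoM rhoZ] := rho_morphism q_gt0 N.
have [_ one1 anti1 gens1] := mu1_antimorphism q_gt0 N.
have [_ one2 anti2 gens2] := mu2_antimorphism q_gt0 N.
(* On indices, [mu2] sends [(i, j)] to [(N.+1 - j, N.+1 - i)], which [mu1] sends to
   [(j - i, N.+1 - i)], the value of [rho]. *)
rewrite (morph_TN_ext (f := rho (N:=N)) (g := mu1 (N:=N) \o mu2 (N:=N))) //=.
- by rewrite mu2_TN mu1_TN.
- by rewrite one2.
- by move=> x y /=; rewrite anti2 anti1.
- exact: rho_qexp.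
- move=> x hx /=; rewrite (mu2_qexp hx) mu1_qexp //.
  by apply: antialg_ext_lowdeg hx => v; apply: Zgen_lowdeg.
- move=> v; rewrite rhoZ gens2; have := vertex_range v => hv.
  rewrite (vertex_range_ind (P := fun i j => mu1 (Z i j) = Z (j - i) j) gens1); last by lia.
  by congr (Zgen _ _ _ _); lia.
Qed.

Lemma mu3_TN : mu3 T = T.
Proof.
have [_ rho1 rhoM rhoZ] := rho_morphism q_gt0 N.
have [_ one1 anti1 gens1] := mu1_antimorphism q_gt0 N.
have [_ one3 anti3 gens3] := mu3_antimorphism q_gt0 N.
(* This replaces the goal by [mu3 (mu1 T) = rho T], where both sides are homomorphisms applied to
   [T]. *)
rewrite -{1}mu1_TN -[RHS]rho_TN.
apply: (morph_TN_ext (f := mu3 (N:=N) \o mu1 (N:=N))) => //=.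
- by rewrite one1.
- by move=> x y /=; rewrite anti1 anti3.
- move=> x hx /=; rewrite (mu1_qexp hx) mu3_qexp //.
  by apply: antialg_ext_lowdeg hx => v; apply: Zgen_lowdeg.
- exact: rho_qexp.
- move=> v; rewrite rhoZ gens1; have := vertex_range v => hv.
  rewrite (vertex_range_ind (P := fun i j => mu3 (Z i j) = Z i (N.+1 + i - j)) gens3); last by lia.
  by congr (Zgen _ _ _ _); lia.
Qed.
End Symmetry.

Theorem theorem1 (R : realType) (q : R) (q_gt0 : 0 < q) (q_lt1 : q < 1)
    (N : nat) (N_ge2 : (2 <= N)%N) :
  [/\ TN q_gt0 N = mu1 (TN q_gt0 N),
      mu1 (TN q_gt0 N) = mu2 (TN q_gt0 N) &
      mu2 (TN q_gt0 N) = mu3 (TN q_gt0 N)]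
  /\ (TN q_gt0 N = rho (TN q_gt0 N) /\
      rho (TN q_gt0 N) = rho (rho (TN q_gt0 N))).
Proof.
rewrite (mu1_TN q_gt0 q_lt1) (mu2_TN q_gt0 q_lt1) (mu3_TN q_gt0 q_lt1).
by rewrite !(rho_TN q_gt0 q_lt1).
Qed.
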